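(* Let $u>0$, $\rho\in\mathbb{R}$, and let $\{X_i\}_{i\ge1}$ be iid random variables with finite mean $\mu>0$. Let $$R_\Lambda^{\alpha_1,\alpha_2}(t)=u+\mu(1+\rho)\Lambda(Y_{\alpha_1,\alpha_2}(t))-\sum_{i=1}^{N_\Lambda^{\alpha_1,\alpha_2}(t)}X_i,\quad t\ge0,$$ where $N_\Lambda^{\alpha_1,\alpha_2}$ is the mixed fractional non-homogeneous Poisson process. Then, with respect to the filtration $$\mathcal{F}_t=\sigma\left(N_\Lambda^{\alpha_1,\alpha_2}(s),\,s\le t\right)\vee\sigma\left(Y_{\alpha_1,\alpha_2}(s),\,s\ge0\right),$$ the process $\{R_\Lambda^{\alpha_1,\alpha_2}(t)\}_{t\ge0}$ is a martingale if $\rho=0$, a submartingale if $\rho>0$, and a supermartingale if $\rho<0$.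
   Context: Fix $0<\alpha_2<\alpha_1<1$ and $C_1,C_2\ge0$ with $C_1+C_2=1$. The mixed stable subordinator $\{D_{\alpha_1,\alpha_2}(t)\}_{t\ge0}$ is the subordinator (non-decreasing L\'evy process) with $\mathbb{E}(e^{-sD_{\alpha_1,\alpha_2}(t)})=e^{-t(C_1s^{\alpha_1}+C_2s^{\alpha_2})}$, $s\ge0$. Its inverse is $Y_{\alpha_1,\alpha_2}(t)=\inf\{s\ge0:D_{\alpha_1,\alpha_2}(s)>t\}$. Let $\Lambda:\mathbb{R}^+\to\mathbb{R}^+$ be a right-continuous non-decreasing function with $\Lambda(0)=0$, $\Lambda(\infty)=\infty$ and $\Lambda(t)-\Lambda(t-)\le1$. The mixed fractional non-homogeneous Poisson process is $N_\Lambda^{\alpha_1,\alpha_2}(t)=N(\Lambda(Y_{\alpha_1,\alpha_2}(t)))$, where $\{N(t)\}_{t\ge0}$ is a Poisson process with intensity $1$ independent of $\{Y_{\alpha_1,\alpha_2}(t)\}_{t\ge0}$. The process $\{N_\Lambda^{\alpha_1,\alpha_2}(t)\}_{t\ge0}$ is assumed to be independent of the sequence $\{X_i\}_{i\ge1}$.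
   Formalization: R is not adapted to F_t, which does not contain the X_i: the formal result gives E[R(t)-R(s)|F_s] =, ≥, ≤ 0 and the full property for F_t ∨ σ(R(s), s≤t); it also assumes E Λ(Y(t)) < ∞ for all t and {X_i} independent of the pair (N_Λ, Y). *)

(* Defs.v *)
From HB Require Import structures.
From mathcomp Require Export all_boot all_order all_algebra.
From mathcomp Require Export all_classical all_reals all_analysis.

Set Implicit Arguments.
Unset Strict Implicit.
Unset Printing Implicit Defensive.

Import Order.TTheory GRing.Theory Num.Theory.
Import numFieldNormedType.Exports.

Local Open Scope classical_set_scope.
Local Open Scope ring_scope.

(* MathComp-Analysis.  Time is the half-line [0, +oo[ of R : a process is
   indexed by R, and every condition on it is restricted to times t >= 0. *)

Section paths.
Context {R : realType}.
Implicit Type f : R -> R.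

Definition nondecreasing_on_pos f : Prop :=
  forall s t, 0 <= s -> s <= t -> f s <= f t.

Definition right_continuous_on_pos f : Prop :=
  forall t, 0 <= t -> f x @[x --> t^'+] --> f t.

Definition cadlag f : Prop :=
  right_continuous_on_pos f /\
  (forall t, 0 < t -> cvg (f x @[x --> t^'-])).

(* The left limits in jumps_le1 exist by monotonicity. *)
Record rate_function (Lambda : R -> R) : Prop := {
  rate_right_continuous : right_continuous_on_pos Lambda ;
  rate_nondecreasing : nondecreasing_on_pos Lambda ;
  rate_at0 : Lambda 0 = 0 ;
  rate_at_infty : Lambda x @[x --> +oo] --> +oo ;
  rate_jumps_le1 : forall t, 0 < t ->
    Lambda t - lim (Lambda x @[x --> t^'-]) <= 1 }.

End paths.

Section sigma_algebras.
Context d (T : measurableType d) (R : realType) (P : probability T R).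

Definition sigma_process (I : Type) d' (U : measurableType d')
    (J : set I) (X : I -> T -> U) : set_system T :=
  <<s \bigcup_(i in J) preimage_set_system setT (X i) measurable >>.

Definition sigma_join (F G : set_system T) : set_system T := <<s F `|` G >>.

Definition independent_sigma (F G : set_system T) : Prop :=
  forall A B, F A -> G B -> P (A `&` B) = (P A * P B)%E.

(* The product rule over subfamilies is the case B i = setT for some i. *)
Definition mutually_independent d' (U : measurableType d') (n : nat)
    (X : 'I_n -> T -> U) : Prop :=
  forall B : 'I_n -> set U, (forall i, measurable (B i)) ->
    P (\bigcap_(i in [set: 'I_n]) (X i @^-1` B i)) =
    (\prod_(i < n) P (X i @^-1` B i))%E.

Definition iid d' (U : measurableType d') (X : nat -> T -> U) : Prop :=
  (forall n, mutually_independent (fun i : 'I_n => X i)) /\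
  (forall i B, measurable B -> P (X i @^-1` B) = P (X 0%N @^-1` B)).

End sigma_algebras.

Section processes.
Context d (T : measurableType d) (R : realType) (P : probability T R).

Definition independent_increments (X : R -> T -> R) : Prop :=
  forall (n : nat) (t : nat -> R), 0 <= t 0%N ->
    {homo t : i j / (i <= j)%N >-> i <= j} ->
    mutually_independent P (fun i : 'I_n => X (t i.+1) \- X (t i)).

Definition stationary_increments (X : R -> T -> R) : Prop :=
  forall s h (B : set R), 0 <= s -> 0 <= h -> measurable B ->
    P ((X (s + h) \- X s) @^-1` B) = P ((X h \- X 0) @^-1` B).

(* Path regularity is required of every path, so that inverse D t is
   measurable although T need not be complete.  Stochastic continuity follows
   from stationarity and right-continuity. *)
Record subordinator (D : R -> {RV P >-> R}) : Prop := {
  subordinator_at0 : {ae P, forall w, D 0 w = 0} ;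
  subordinator_independent : independent_increments (fun t => D t) ;
  subordinator_stationary : stationary_increments (fun t => D t) ;
  subordinator_cadlag : forall w, cadlag (fun t => D t w) ;
  subordinator_nondecreasing : forall w, nondecreasing_on_pos (fun t => D t w) }.

Definition mixed_stable_subordinator (a1 a2 C1 C2 : R)
    (D : R -> {RV P >-> R}) : Prop :=
  subordinator D /\
  (forall s t, 0 <= s -> 0 <= t ->
    ('E_P[fun w => expR (- s * D t w)%R] =
     (expR (- t * (C1 * s `^ a1 + C2 * s `^ a2)))%:E)%E).

(* The set is nonempty for almost every w when D is a mixed stable
   subordinator; elsewhere inf set0 = 0. *)
Definition inverse (D : R -> T -> R) (t : R) (w : T) : R :=
  inf [set s | 0 <= s /\ t < D s w].

Record poisson_process (lambda : R) (N : R -> {RV P >-> nat}) : Prop := {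
  poisson_at0 : {ae P, forall w, N 0 w = 0%N} ;
  poisson_independent : independent_increments (fun t w => (N t w)%:R) ;
  poisson_law : forall s t (k : nat), 0 <= s -> s < t ->
    P [set w | N t w = (N s w + k)%N] = (poisson_pmf (lambda * (t - s)) k)%:E ;
  poisson_cadlag : forall w, cadlag (fun t => (N t w)%:R : R) ;
  poisson_nondecreasing : forall w,
    nondecreasing_on_pos (fun t => (N t w)%:R : R) }.

Definition time_changed_count (N : R -> T -> nat) (Lambda : R -> R)
    (Y : R -> T -> R) (t : R) (w : T) : nat := N (Lambda (Y t w)) w.

(* X i is the claim size with index i + 1. *)
Definition risk_process (u mu rho : R) (Lambda : R -> R) (Y : R -> T -> R)
    (NL : R -> T -> nat) (X : nat -> T -> R) (t : R) (w : T) : R :=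
  u + mu * (1 + rho) * Lambda (Y t w) - \sum_(i < NL t w) X i w.

Definition claim_filtration (NL : R -> T -> nat) (Y : R -> T -> R) (t : R) :
    set_system T :=
  sigma_join (sigma_process [set s | 0 <= s <= t] NL)
             (sigma_process [set s | 0 <= s] Y).

(* The smallest filtration that contains F and to which M is adapted.  The
   risk process is not adapted to claim_filtration, which does not see the
   claim sizes. *)
Definition augment (F : R -> set_system T) (M : R -> T -> R) (t : R) :
    set_system T :=
  sigma_join (F t) (sigma_process [set s | 0 <= s <= t] M).

End processes.

Section martingales.
Context d (T : measurableType d) (R : realType) (P : probability T R).

Definition filtration (F : R -> set_system T) : Prop :=
  (forall t, 0 <= t -> sigma_algebra setT (F t) /\ F t `<=` measurable) /\
  (forall s t, 0 <= s -> s <= t -> F s `<=` F t).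

Definition measurable_wrt (G : set_system T) (Z : T -> R) : Prop :=
  forall B, measurable B -> G (Z @^-1` B).

Definition integrable_rv (Z : T -> R) : Prop :=
  P.-integrable setT (EFin \o Z).

(* Z is a version of E[X | G]. *)
Record conditional_expectation (G : set_system T) (X Z : T -> R) : Prop := {
  condexp_measurable : measurable_wrt G Z ;
  condexp_integrable : integrable_rv Z ;
  condexp_integral : forall A, G A ->
    (\int[P]_(w in A) (Z w)%:E = \int[P]_(w in A) (X w)%:E)%E }.

(* cmp compares M s with E[M t | F s]. *)
Record martingale_with (cmp : R -> R -> Prop)
    (F : R -> set_system T) (M : R -> T -> R) : Prop := {
  martingale_filtration : filtration F ;
  martingale_adapted : forall t, 0 <= t -> measurable_wrt (F t) (M t) ;
  martingale_integrable : forall t, 0 <= t -> integrable_rv (M t) ;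
  martingale_condexp : forall s t, 0 <= s -> s <= t ->
    exists Z, conditional_expectation (F s) (M t) Z /\
      {ae P, forall w, cmp (M s w) (Z w)} }.

Definition martingale := martingale_with (fun x y => x = y).
Definition submartingale := martingale_with (fun x y => x <= y).
Definition supermartingale := martingale_with (fun x y => y <= x).

(* The same three notions without adaptedness, expressed through
   E[M t - M s | F s], which cmp compares with 0; for an adapted process they
   coincide with the notions above. *)
Record increment_martingale_with (cmp : R -> R -> Prop)
    (F : R -> set_system T) (M : R -> T -> R) : Prop := {
  incr_martingale_filtration : filtration F ;
  incr_martingale_integrable : forall t, 0 <= t -> integrable_rv (M t) ;
  incr_martingale_condexp : forall s t, 0 <= s -> s <= t ->
    exists Z, conditional_expectation (F s) (M t \- M s) Z /\
      {ae P, forall w, cmp 0 (Z w)} }.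

Definition increment_martingale :=
  increment_martingale_with (fun x y => x = y).
Definition increment_submartingale :=
  increment_martingale_with (fun x y => x <= y).
Definition increment_supermartingale :=
  increment_martingale_with (fun x y => y <= x).

End martingales.

(* Main.v *)
Require Import Defs.
From mathcomp Require Import all_boot all_order all_algebra.
From mathcomp Require Import all_classical all_reals all_analysis.
From mathcomp Require Import measurable_realfun ring lra.

Set Implicit Arguments.
Unset Strict Implicit.
Unset Printing Implicit Defensive.

Import Order.TTheory GRing.Theory Num.Theory.
Import numFieldNormedType.Exports.

Local Open Scope classical_set_scope.
Local Open Scope ring_scope.

(* Write tau_t = Lambda (Y t).  For A in G_s, both steps below are instances of
   Wald's identity: a sum of terms indexed by the integers between two random
   times is integrated term by term, and each term is independent of the trace
   of A on the event where that term occurs in the sum.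
   First, N at tau_s and tau_t is approximated from the right along the grid of
   mesh 1/(n+1), where N increases by a sum of increments over grid cells.  On
   {tau_s < a} an event of F_s is determined by Y and by N up to time a, hence
   independent of the increments of N after a.  As n tends to infinity, this
   gives E[N(tau_t) - N(tau_s); A] = E[tau_t - tau_s; A] for A in F_s, and the
   equality extends to G_s because X is independent of (N o tau, Y).
   Second, on {N(tau_s) <= i} an event of G_s is determined by (N o tau, Y) and
   by the claims of index below i, hence independent of X_i.  So the claims paid
   between s and t have mean mu E[tau_t - tau_s; A] on A, and
   E[R_t - R_s; A] = mu rho E[tau_t - tau_s; A].
   The traces are taken inside the almost sure event E where D is unbounded and
   N 0 = 0: outside E the paths of Y need not be monotone. *)

(** * Sub-sigma-algebras and independence *)

Lemma sigma_setI (T : Type) (H : set_system T) :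
  sigma_algebra setT H -> setI_closed H.
Proof. by move=> sH; have /(sigma_algebraP (fun _ _ => @subsetT _ _))[] := sH. Qed.

Lemma sigma_setT (T : Type) (H : set_system T) :
  sigma_algebra setT H -> H setT.
Proof. by move=> sH; have /(sigma_algebraP (fun _ _ => @subsetT _ _))[] := sH. Qed.

Lemma sigma_setC (T : Type) (H : set_system T) A :
  sigma_algebra setT H -> H A -> H (~` A).
Proof. by move=> [_ HC _] HA; rewrite -setTD; exact: HC. Qed.

Lemma sigma_join_sub d (T : measurableType d) (F G H : set_system T) :
  sigma_algebra setT H -> F `<=` H -> G `<=` H -> sigma_join F G `<=` H.
Proof. by move=> sH FH GH; apply: smallest_sub => // A [/FH|/GH]. Qed.

Lemma sigma_join_l d (T : measurableType d) (F G : set_system T) :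
  F `<=` sigma_join F G.
Proof. by move=> A FA; apply: sub_sigma_algebra; left. Qed.

Lemma sigma_join_r d (T : measurableType d) (F G : set_system T) :
  G `<=` sigma_join F G.
Proof. by move=> A GA; apply: sub_sigma_algebra; right. Qed.

(** The sets [A] whose trace on [E] is also the trace of a member of [H] form a sigma-algebra, so
    generators suffice. This replaces an event by one of a more convenient sigma-algebra on a set
    [E] that need not lie in [H]. *)
Lemma sigma_trace (T : Type) (G H : set_system T) (E : set T) :
  sigma_algebra setT H ->
  (forall A, G A -> exists A', H A' /\ A `&` E = A' `&` E) ->
  forall A, <<s G >> A -> exists A', H A' /\ A `&` E = A' `&` E.
Proof.
move=> sH GH.
suff : <<s G >> `<=` [set A | exists A', H A' /\ A `&` E = A' `&` E] by [].
apply: smallest_sub => //; have [H0 HC HU] := sH; split => /=.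
- by exists set0.
- move=> A [A' [HA' AE]]; exists (setT `\` A'); split; first exact: HC.
  rewrite !setTD; apply/seteqP; split=> w [nA Ew]; split=> // Aw; apply: nA.
    by have [] : (A `&` E) w by rewrite AE.
  by have [] : (A' `&` E) w by rewrite -AE.
- move=> A_ /choice[A_' HA'_].
  exists (\bigcup_i A_' i); split; first by apply: HU => i; have [] := HA'_ i.
  by rewrite !setI_bigcupl; apply: eq_bigcupr => i _; have [] := HA'_ i.
Qed.

(** * Extension of integral identities and of independence from pi-systems *)

Section integrals.
Context d (T : measurableType d) (R : realType) (P : probability T R).
Local Open Scope ereal_scope.

(** Dynkin's argument: the measurable sets over which the two integrals agree form a lambda-system
    containing the pi-system [G]. *)
Lemma integral_eq_setI_closed (G : set_system T) (f g : T -> \bar R) :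
  setI_closed G -> G setT -> G `<=` measurable ->
  P.-integrable setT f -> P.-integrable setT g ->
  (forall A, G A -> \int[P]_(w in A) f w = \int[P]_(w in A) g w) ->
  forall A, <<s G >> A -> \int[P]_(w in A) f w = \int[P]_(w in A) g w.
Proof.
move=> GI GT Gm fi gi fg A.
have fiS B : measurable B -> P.-integrable B f.
  by move=> mB; apply: integrableS fi.
have giS B : measurable B -> P.-integrable B g.
  by move=> mB; apply: integrableS gi.
suff : <<s G >> `<=` [set B | measurable B /\
    \int[P]_(w in B) f w = \int[P]_(w in B) g w] by move=> H /H[].
apply: lambda_system_subset => //; last first.
  by move=> B GB; split; [exact: Gm|exact: fg].
apply/dynkin_lambda_system; split => /=.
- by split=> //; exact: fg.
- move=> B [mB Bfg]; have mCB := measurableC mB; split => //.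
  (* The integrals over [B] are finite, so they cancel from the identity over the whole space and
     leave the one over the complement. *)
  have := fg _ GT; rewrite -(setUv B) !integral_setU//.
  + rewrite Bfg => /(congr1 (fun x => x - \int[P]_(w in B) g w)).
    by rewrite ![_ + \int[P]_(w in ~` B) _ w]addeC !addeK//;
      exact: integrable_fin_num (giS _ mB).
  + by rewrite setUv; exact: measurable_int gi.
  + by apply/disj_setPS; rewrite setICr.
  + by rewrite setUv; exact: measurable_int fi.
  + by apply/disj_setPS; rewrite setICr.
- move=> F tF /all_and2[mF Ffg]; split; first exact: bigcupT_measurable.
  rewrite !integral_bigcup//; last 2 first.
  + by apply: giS; exact: bigcupT_measurable.
  + by apply: fiS; exact: bigcupT_measurable.
  by apply: eq_eseriesr => i _; exact: Ffg.
Qed.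

(** The intersections of a member of [F] with a member of [G] form a pi-system that generates the
    join. *)
Lemma integral_eq_sigma_join (F G : set_system T) (f g : T -> \bar R) :
  sigma_algebra setT F -> sigma_algebra setT G ->
  F `<=` measurable -> G `<=` measurable ->
  P.-integrable setT f -> P.-integrable setT g ->
  (forall A B, F A -> G B ->
    \int[P]_(w in A `&` B) f w = \int[P]_(w in A `&` B) g w) ->
  forall A, sigma_join F G A -> \int[P]_(w in A) f w = \int[P]_(w in A) g w.
Proof.
move=> sF sG Fm Gm fi gi fg A.
pose H : set_system T := [set C | exists A B, [/\ F A, G B & C = A `&` B]].
have FT := sigma_setT sF; have GT := sigma_setT sG.
move=> AFG; apply: (@integral_eq_setI_closed H) => //.
- move=> _ _ [A1 [B1 [FA1 GB1 ->]]] [A2 [B2 [FA2 GB2 ->]]].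
  exists (A1 `&` A2), (B1 `&` B2); rewrite setIACA; split => //.
    exact: sigma_setI.
  exact: sigma_setI.
- by exists setT, setT; rewrite setIT.
- by move=> _ [A1 [B1 [/Fm FA1 /Gm GB1 ->]]]; exact: measurableI.
- by move=> _ [A1 [B1 [FA1 GB1 ->]]]; exact: fg.
- apply: sigma_join_sub AFG => // B ?; apply: sub_sigma_algebra.
    by exists B, setT; rewrite setIT.
  by exists setT, B; rewrite setTI.
Qed.

Lemma integral_cst_indic (c : R) (A B : set T) : measurable A -> measurable B ->
  \int[P]_(w in A) (c * \1_B w)%:E = c%:E * P (A `&` B).
Proof.
move=> mA mB.
under eq_integral do rewrite EFinM.
rewrite integralZl//; first by rewrite integral_indic// setIC.
by apply: integrableS (integrable_indic _ _) => //.
Qed.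

(** Both sides are integrals over [A], of the indicator of [C] and of the constant [c], so this is
    the preceding pi-system argument. *)
Lemma measure_eq_setI_closed (G : set_system T) (C : set T) (c : R) :
  setI_closed G -> G setT -> G `<=` measurable -> measurable C ->
  (forall A, G A -> P (A `&` C) = P A * c%:E) ->
  forall A, <<s G >> A -> P (A `&` C) = P A * c%:E.
Proof.
move=> GI GT Gm mC GC A sGA.
have sGm : <<s G >> `<=` measurable.
  by apply: smallest_sub => //; exact: sigma_algebra_measurable.
have E1 B : measurable B -> \int[P]_(w in B) (1 * \1_C w)%:E = P (B `&` C).
  by move=> mB; rewrite integral_cst_indic// mul1e.
have E2 B : measurable B -> \int[P]_(w in B) (c * \1_setT w)%:E = P B * c%:E.
  by move=> mB; rewrite integral_cst_indic// setIT muleC.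
have mA := sGm _ sGA.
have mcint D e : measurable D -> P.-integrable setT (fun w => (e * \1_D w)%:E).
  move=> mD; under eq_fun do rewrite EFinM.
  by apply: integrableZl => //; exact: integrable_indic.
rewrite -E1// -E2//; apply: (@integral_eq_setI_closed G) => //.
- exact: mcint.
- exact: mcint.
- by move=> B GB; have mB := Gm _ GB; rewrite E1// E2// GC.
Qed.

Lemma independent_sigma_join (F G H : set_system T) :
  sigma_algebra setT F -> sigma_algebra setT G ->
  F `<=` measurable -> G `<=` measurable -> H `<=` measurable ->
  (forall A B C, F A -> G B -> H C -> P (A `&` B `&` C) = P (A `&` B) * P C) ->
  independent_sigma P (sigma_join F G) H.
Proof.
move=> sF sG Fm Gm Hm FGH A C AFG HC.
pose K : set_system T := [set C | exists A B, [/\ F A, G B & C = A `&` B]].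
have FT := sigma_setT sF; have GT := sigma_setT sG.
have mC := Hm _ HC.
have Cfin : P C \is a fin_num by exact: fin_num_measure.
rewrite -(fineK Cfin); apply: (@measure_eq_setI_closed K) => //.
- move=> _ _ [A1 [B1 [FA1 GB1 ->]]] [A2 [B2 [FA2 GB2 ->]]].
  exists (A1 `&` A2), (B1 `&` B2); rewrite setIACA; split => //.
    exact: sigma_setI.
  exact: sigma_setI.
- by exists setT, setT; rewrite setIT.
- by move=> _ [A1 [B1 [/Fm FA1 /Gm GB1 ->]]]; exact: measurableI.
- by move=> _ [A1 [B1 [FA1 GB1 ->]]]; rewrite fineK//; exact: FGH.
- apply: sigma_join_sub AFG => // B ?; apply: sub_sigma_algebra.
    by exists B, setT; rewrite setIT.
  by exists setT, B; rewrite setTI.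
Qed.

Lemma ge0_integral_mrestr (C : set T) (mC : measurable C) (f : T -> \bar R) :
  measurable_fun setT f -> (forall w, 0 <= f w) ->
  \int[mrestr P mC]_w f w = \int[P]_(w in C) f w.
Proof.
move=> mf f0.
rewrite (@ge0_negligible_integral _ _ _ (mrestr P mC) setT (~` C))//.
- rewrite setTD setCK; apply: eq_measure_integral => A mA AC.
  by rewrite /= /mrestr setIidl.
- exact: measurableC.
- by rewrite /= /mrestr setICl measure0.
Qed.

(** The law of [xi] under [P] restricted to [C] is [P C] times its law under [P], so both sides
    integrate [f] against the same image measure. *)
Lemma ge0_integral_independent (C : set T) (xi : T -> R) (f : R -> R) :
  measurable C -> measurable_fun setT xi -> measurable_fun setT f ->
  (forall x, 0 <= f x)%R ->
  (forall S, measurable S -> P (C `&` xi @^-1` S) = P C * P (xi @^-1` S)) ->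
  \int[P]_(w in C) (f (xi w))%:E = P C * \int[P]_w (f (xi w))%:E.
Proof.
move=> mC mxi mf f0 CS.
have mfE : measurable_fun setT (EFin \o f) by exact/measurable_EFinP.
have mfxi : measurable_fun setT (EFin \o f \o xi) by exact: measurableT_comp.
rewrite -(ge0_integral_mrestr mC)//; last by move=> w; rewrite lee_fin.
have Cfin : P C \is a fin_num by exact: fin_num_measure.
have C0 : (0 <= fine (P C))%R by exact: fine_ge0.
rewrite (_ : \int[mrestr P mC]_w _ =
    \int[mrestr P mC]_(w in xi @^-1` setT) (EFin \o f \o xi) w)//.
rewrite -ge0_integral_pushforward//; last by move=> x _; rewrite lee_fin.
rewrite (_ : \int[P]_w _ = \int[P]_(w in xi @^-1` setT) (EFin \o f \o xi) w)//.
rewrite -(@ge0_integral_pushforward _ _ _ _ _ _ mxi P setT)//; last first.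
  by move=> x _; rewrite lee_fin.
rewrite -(fineK Cfin) -[fine (P C)]/((NngNum C0)%:num)%R.
rewrite -ge0_integral_mscale//; last by move=> x _; rewrite lee_fin.
apply: eq_measure_integral => S mS _.
rewrite /= /mscale/= fineK//.
by rewrite /pushforward /mrestr setIC CS.
Qed.

End integrals.

Section measurability.
Context {d} {T : measurableType d} {R : realType}.

Lemma measurable_wrtP (G : set_system T) (Z : T -> R) :
  measurable_wrt <<s G >> Z <->
  @measurable_fun _ _ (g_sigma_algebraType G) R setT Z.
Proof.
split=> [mZ _ B mB|mZ B mB]; first by rewrite setTI; exact: mZ.
by rewrite -[_ @^-1` _]setTI; exact: mZ.
Qed.

Lemma measurable_natr (f : T -> nat) :
  measurable_fun setT (fun w => (f w)%:R : R) -> measurable_fun setT f.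
Proof.
move=> mf _ S _; rewrite setTI.
have -> : f @^-1` S = (fun w => (f w)%:R : R) @^-1` \bigcup_(k in S) [set k%:R].
  apply/seteqP; split=> w /=; first by move=> Sw; exists (f w).
  by case=> k Sk /eqP; rewrite eqr_nat => /eqP ->.
rewrite -[_ @^-1` _]setTI; apply: mf => //.
by apply: bigcup_measurable => k _; exact: measurable_set1.
Qed.

Lemma measurable_nat_index d' (U : measurableType d') (g : nat -> T -> U)
    (k : T -> nat) :
  (forall n, measurable_fun setT (g n)) -> measurable_fun setT k ->
  measurable_fun setT (fun w => g (k w) w).
Proof.
move=> mg mk _ S mS; rewrite setTI.
have -> : (fun w => g (k w) w) @^-1` S =
    \bigcup_n (k @^-1` [set n] `&` g n @^-1` S).
  apply/seteqP; split=> w /=; first by move=> Sw; exists (k w).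
  by case=> n _ [/= <-].
apply: bigcupT_measurable => n; apply: measurableI.
  by rewrite -[_ @^-1` _]setTI; exact: mk.
by rewrite -[_ @^-1` _]setTI; exact: mg.
Qed.

End measurability.

(** * Random times and random sums *)

Section grid.
Context {R : realType}.
Implicit Types (x y : R) (n k : nat) (f : R -> R).

(** For [x >= 0], the index of the first point of the grid of mesh [1 / n.+1] strictly to the right
    of [x]. Strictness is what lets limits along the grids use right-continuity alone. *)
Definition grid n x : nat := (Num.truncn (x * n.+1%:R)).+1.

Definition mesh n k : R := k%:R / n.+1%:R.

Lemma grid_le_nat n x k : 0 <= x -> (grid n x <= k)%N = (x < mesh n k).
Proof.
by move=> x0; rewrite /grid /mesh truncn_lt_nat ?mulr_ge0// ltr_pdivlMr.
Qed.

Lemma lt_mesh_grid n x : 0 <= x -> x < mesh n (grid n x).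
Proof. by move=> x0; rewrite -grid_le_nat. Qed.

Lemma mesh_grid_le n x : 0 <= x -> mesh n (grid n x) <= x + n.+1%:R^-1.
Proof.
move=> x0; rewrite /mesh /grid -natr1 mulrDl mul1r lerD2r.
by rewrite ler_pdivrMr// truncn_le mulr_ge0.
Qed.

Lemma le_grid n x y : x <= y -> (grid n x <= grid n y)%N.
Proof. by move=> xy; rewrite ltnS le_truncn// ler_wpM2r. Qed.

Lemma mesh_ge0 n k : 0 <= mesh n k.
Proof. by rewrite divr_ge0. Qed.

Lemma le_mesh n k l : (k <= l)%N -> mesh n k <= mesh n l.
Proof. by move=> kl; rewrite ler_wpM2r ?invr_ge0// ler_nat. Qed.

Lemma cvg_mesh_grid x : 0 <= x -> mesh n (grid n x) @[n --> \oo] --> x.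
Proof.
move=> x0; apply: (@squeeze_cvgr _ _ _ _ (cst x) (fun n => x + n.+1%:R^-1)).
- by near=> n; rewrite mesh_grid_le// andbT ltW// lt_mesh_grid.
- exact: cvg_cst.
- rewrite -[X in _ --> X]addr0; apply: cvgD; first exact: cvg_cst.
  exact: cvg_harmonic.
Unshelve. all: by end_near. Qed.

Lemma cvg_right_mesh_grid f x : 0 <= x -> f y @[y --> x^'+] --> f x ->
  f (mesh n (grid n x)) @[n --> \oo] --> f x.
Proof.
move=> x0 fx; apply: cvg_comp fx => A; rewrite /at_right /within/= => xA.
have /= : \forall n \near \oo, x < mesh n (grid n x) -> A (mesh n (grid n x)).
  exact: (cvg_mesh_grid x0 xA).
by apply: filterS => n; apply; exact: lt_mesh_grid.
Qed.

Lemma measurable_grid d (T : measurableType d) (tau : T -> R) n :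
  measurable_fun setT tau -> measurable_fun setT (fun w => grid n (tau w)).
Proof.
move=> mtau; apply: (@measurable_natr _ _ R).
apply: (@measurableT_comp _ _ _ _ _ _ (fun x => (grid n x)%:R : R)) => //.
apply: nondecreasing_measurable => // x y xy.
by rewrite ler_nat le_grid.
Qed.

(** Right-continuity makes the value at [tau] the limit of the values at the grid points just after
    [tau]; each of these is a choice among countably many measurable functions. *)
Lemma measurable_random_time d (T : measurableType d) (M : R -> T -> R)
    (tau : T -> R) :
  (forall t, 0 <= t -> measurable_fun setT (M t)) ->
  (forall w, right_continuous_on_pos (M ^~ w)) ->
  (forall w, 0 <= tau w) -> measurable_fun setT tau ->
  measurable_fun setT (fun w => M (tau w) w).
Proof.
move=> mM rM tau0 mtau.
apply: (@measurable_fun_cvg _ _ _ _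
  (fun n w => M (mesh n (grid n (tau w))) w)); last first.
  by move=> w _; apply: (@cvg_right_mesh_grid (M ^~ w)) => //; exact: rM.
move=> n.
apply: (@measurable_nat_index _ _ _ _ (fun k => M (mesh n k))
  (fun w => grid n (tau w))); first by move=> k; apply: mM; exact: mesh_ge0.
exact: measurable_grid.
Qed.

End grid.

(** Moves the bounds of a sum into its terms: a sum with random bounds becomes a series over a fixed
    range, which can be exchanged with the integral. *)
Lemma nneseries_ereal_nat_interval (R : realType) (x : nat -> R) (s t : nat) :
  (\sum_(k <oo) (if (s <= k < t)%N then (x k)%:E else 0) =
   (\sum_(s <= k < t) x k)%:E)%E.
Proof.
apply: lim_near_cst => //; near=> n.
have tn : (t <= n)%N by near: n; exact: nbhs_infty_ge.
rewrite (big_nat_widen _ _ _ _ _ tn) -sumEFin -big_mkcond/=.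
by rewrite [RHS](big_nat_widenl _ 0)//; apply: eq_bigl => k; rewrite andbC.
Unshelve. all: by end_near. Qed.

(** * Wald's identity for sums between two random indices *)

Section random_sums.
Context d (T : measurableType d) (R : realType) (P : probability T R).
Implicit Types (A : set T) (sg tau : T -> nat) (xi : nat -> T -> R).

Lemma measurable_nat_between sg tau k :
  measurable_fun setT sg -> measurable_fun setT tau ->
  measurable [set w | (sg w <= k < tau w)%N].
Proof.
move=> msg mtau.
have -> : [set w | (sg w <= k < tau w)%N] =
    sg @^-1` [set i | (i <= k)%N] `&` tau @^-1` [set i | (k < i)%N].
  by apply/seteqP; split=> w /= => [/andP//|[-> ->]].
by apply: measurableI; rewrite -[_ @^-1` _]setTI; [exact: msg|exact: mtau].
Qed.

Lemma measurable_random_sum sg tau xi :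
  measurable_fun setT sg -> measurable_fun setT tau ->
  (forall k, measurable_fun setT (xi k)) ->
  measurable_fun setT (fun w => \sum_(sg w <= k < tau w) xi k w).
Proof.
move=> msg mtau mxi.
apply: (@measurable_nat_index _ _ _ _ (fun m w => \sum_(sg w <= k < m) xi k w)
  tau) => // m.
apply: (@measurable_nat_index _ _ _ _ (fun l w => \sum_(l <= k < m) xi k w)
  sg) => // l.
exact: measurable_sum.
Qed.

Lemma ge0_integral_random_sum A sg tau xi :
  measurable A -> measurable_fun setT sg -> measurable_fun setT tau ->
  (forall k, measurable_fun setT (xi k)) -> (forall k w, 0 <= xi k w) ->
  (\int[P]_(w in A) (\sum_(sg w <= k < tau w) xi k w)%:E =
   \sum_(k <oo) \int[P]_(w in A `&` [set w | (sg w <= k < tau w)%N])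
     (xi k w)%:E)%E.
Proof.
move=> mA msg mtau mxi xi0.
under eq_integral do rewrite -nneseries_ereal_nat_interval.
have mB k := measurable_nat_between k msg mtau.
rewrite integral_nneseries//.
- apply: eq_eseriesr => k _.
  rewrite integral_mkcondr; apply: eq_integral => w _.
  by rewrite patchE mem_setE.
- move=> k; apply: measurable_funTS.
  apply: measurable_fun_ifT => //; last exact/measurable_EFinP.
  apply: (measurable_fun_bool true).
  by rewrite setTI; exact: mB.
- by move=> k w _; case: ifPn => // _; rewrite lee_fin.
Qed.

(** Independence enters only through [xic]: the [k]-th term has mean [c] on the part of [A] where it
    occurs. Summing over [k] gives [c] times the mean number of terms, and nonnegativity allows
    infinite values. *)
Lemma ge0_wald A sg tau xi (c : R) :
  measurable A -> measurable_fun setT sg -> measurable_fun setT tau ->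
  (forall k, measurable_fun setT (xi k)) -> (forall k w, 0 <= xi k w) ->
  0 <= c ->
  (forall k, \int[P]_(w in A `&` [set w | (sg w <= k < tau w)%N]) (xi k w)%:E =
    c%:E * P (A `&` [set w | (sg w <= k < tau w)%N]))%E ->
  (\int[P]_(w in A) (\sum_(sg w <= k < tau w) xi k w)%:E =
   c%:E * \int[P]_(w in A) (tau w - sg w)%N%:R%:E)%E.
Proof.
move=> mA msg mtau mxi xi0 c0 xic.
have mB k := measurable_nat_between k msg mtau.
have -> : (\int[P]_(w in A) (tau w - sg w)%N%:R%:E =
    \int[P]_(w in A) (\sum_(sg w <= k < tau w) (1 : R))%:E)%E.
  by apply: eq_integral => w _; rewrite sumr_const_nat.
rewrite !ge0_integral_random_sum// -nneseriesZl//; last first.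
  by move=> k _; apply: integral_ge0.
apply: eq_eseriesr => k _; rewrite xic integral_cst ?mul1e//.
exact: measurableI.
Qed.

End random_sums.

Section sigma_process.
Context d (T : measurableType d) d' (U : measurableType d').
Implicit Types (H : set_system T).

Lemma sigma_process_preimage (I : Type) (J : set I) (X : I -> T -> U) i B :
  J i -> measurable B -> sigma_process J X (X i @^-1` B).
Proof.
move=> Ji mB; apply: sub_sigma_algebra; exists i => //.
by exists B => //; rewrite setTI.
Qed.

Lemma sigma_process_sub (I : Type) (J : set I) (X : I -> T -> U) H :
  sigma_algebra setT H ->
  (forall i B, J i -> measurable B -> H (X i @^-1` B)) ->
  sigma_process J X `<=` H.
Proof.
move=> sH XH; apply: smallest_sub => // _ [i Ji [B mB <-]].
by rewrite setTI; exact: XH.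
Qed.

Lemma sigma_process_measurable (I : Type) (J : set I) (X : I -> T -> U) :
  (forall i, J i -> measurable_fun setT (X i)) ->
  sigma_process J X `<=` measurable.
Proof.
move=> mX; apply: sigma_process_sub => [|i B Ji mB].
  exact: sigma_algebra_measurable.
by rewrite -[_ @^-1` _]setTI; exact: mX.
Qed.

End sigma_process.

(** * Independence from the past of a family of random variables *)

Section independence.
Context d (T : measurableType d) (R : realType) (P : probability T R).
Context d' (U : measurableType d').
Local Open Scope ereal_scope.

(** Finite lists of constraints on coordinates describe a generating pi-system. An index may occur
    repeatedly in a list, so intersecting two such events is concatenation. *)
Lemma independent_sigma_process (I : choiceType) (J : set I) (X : I -> T -> U)
    (C : set T) :
  (forall i, J i -> measurable_fun setT (X i)) -> measurable C ->
  (forall s : seq (I * set U),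
    (forall p, p \in s -> J p.1 /\ measurable p.2) ->
    P (\big[setI/setT]_(p <- s) (X p.1 @^-1` p.2) `&` C) =
    P (\big[setI/setT]_(p <- s) (X p.1 @^-1` p.2)) * P C) ->
  forall A, sigma_process J X A -> P (A `&` C) = P A * P C.
Proof.
move=> mX mC indC A JXA.
pose G : set_system T := [set A | exists2 s : seq (I * set U),
  (forall p, p \in s -> J p.1 /\ measurable p.2) &
  A = \big[setI/setT]_(p <- s) (X p.1 @^-1` p.2)].
have Cfin : P C \is a fin_num by exact: fin_num_measure.
rewrite -(fineK Cfin); apply: (@measure_eq_setI_closed _ _ _ _ G) => //.
- move=> _ _ [s1 Hs1 ->] [s2 Hs2 ->]; exists (s1 ++ s2); rewrite ?big_cat//.
  by move=> p; rewrite mem_cat => /orP[/Hs1|/Hs2].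
- by exists [::]; rewrite ?big_nil.
- move=> _ [s Hs ->]; rewrite big_seq; apply: bigsetI_measurable => p /Hs[Jp mp].
  by rewrite -[_ @^-1` _]setTI; exact: mX.
- by move=> _ [s Hs ->]; rewrite fineK// indC.
- apply: sigma_process_sub JXA => // i B Ji mB; apply: sub_sigma_algebra.
  exists [:: (i, B)]; last by rewrite big_seq1.
  by move=> p; rewrite inE => /eqP ->.
Qed.

(** The cylinders over the first [n] coordinates form a pi-system generating the past. *)
Lemma mutually_independent_past (X : nat -> T -> U) (n : nat) (A : set T)
    (B : set U) :
  (forall i, measurable_fun setT (X i)) ->
  mutually_independent P (fun i : 'I_n.+1 => X i) ->
  sigma_process [set i | (i < n)%N] X A -> measurable B ->
  P (A `&` X n @^-1` B) = P A * P (X n @^-1` B).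
Proof.
move=> mX indX XA mB.
have mXB i S : measurable S -> measurable (X i @^-1` S).
  by move=> mS; rewrite -[_ @^-1` _]setTI; exact: mX.
pose G : set_system T := [set A | exists2 S : nat -> set U,
  (forall i, measurable (S i)) &
  A = \bigcap_(i in [set i | (i < n)%N]) (X i @^-1` S i)].
have GE (S : nat -> set U) (C : set U) :
    (forall i, measurable (S i)) -> measurable C ->
    P (\bigcap_(i in [set i | (i < n)%N]) (X i @^-1` S i) `&` X n @^-1` C) =
    \prod_(i < n) P (X i @^-1` S i) * P (X n @^-1` C).
  move=> mS mC.
  have := indX (fun i => if (i < n)%N then S i else C).
  rewrite big_ord_recr/= ltnn.
  under eq_bigr do rewrite ltn_ord.
  move=> <-; last by move=> i; case: ifP.
  congr (P _); apply/seteqP; split=> w /=.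
    move=> [wS wC] i _ /=; case: ifPn => [|] iltn; first exact: wS.
    by have -> : i = n :> nat by apply/eqP; rewrite eqn_leq -ltnS ltn_ord leqNgt.
  move=> wS; split.
    move=> i /= iltn.
    by have := wS (Ordinal (ltn_trans iltn (ltnSn n))) I; rewrite /= iltn.
  by have := wS ord_max I; rewrite /= ltnn.
have mC := mXB n _ mB.
have Cfin : P (X n @^-1` B) \is a fin_num by exact: fin_num_measure.
rewrite -(fineK Cfin); apply: (@measure_eq_setI_closed _ _ _ _ G) => //.
- move=> _ _ [S1 mS1 ->] [S2 mS2 ->]; exists (fun i => S1 i `&` S2 i).
    by move=> i; exact: measurableI.
  by rewrite -bigcapI.
- by exists (fun=> setT) => //; apply/seteqP; split.
- move=> _ [S mS ->]; apply: bigcap_measurableType => i _; exact: mXB.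
- move=> _ [S mS ->]; rewrite fineK// GE//; congr (_ * _).
  (* With [setT] as the last constraint, the product formula gives the probability of the cylinder
     itself. *)
  have := GE S setT mS measurableT.
  by rewrite preimage_setT setIT probability_setT mule1.
- apply: sigma_process_sub XA => // i S iltn mS; apply: sub_sigma_algebra.
  exists (fun j => if j == i then S else setT).
    by move=> j; case: ifP.
  apply/seteqP; split=> w /= wS.
    by move=> j jn; case: eqP => // ->.
  by have := wS i iltn; rewrite eqxx.
Qed.

End independence.

Section increments.
Context d (T : measurableType d) (R : realType) (P : probability T R).

(** An event of the past is tested on finitely many times. Once these are sorted and completed by
    [0], [a] and [b], the past values are sums of early increments and [M b \- M a] is the last
    one. *)
Lemma independent_increments_past (M : R -> T -> R) (a b : R) (A : set T)
    (B : set R) :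
  (forall t, 0 <= t -> measurable_fun setT (M t)) ->
  independent_increments P M -> 0 <= a -> a <= b ->
  sigma_process [set r | 0 <= r <= a] (fun r => M r \- M 0) A ->
  measurable B ->
  P (A `&` (M b \- M a) @^-1` B) = (P A * P ((M b \- M a)%R @^-1` B))%E.
Proof.
move=> mM indM a0 ab MA mB.
have b0 := le_trans a0 ab.
move: A MA; apply: independent_sigma_process.
- by move=> r /andP[r0 _]; apply: measurable_funB; exact: mM.
- by rewrite -[_ @^-1` _]setTI; apply: measurable_funB => //; exact: mM.
move=> s Js.
(* The default value [b] of [nth] extends the list: [t] takes the value [a] at [(size s).+1] and
   stays at [b] from [(size s).+2] on. Repeated times only contribute zero increments. *)
pose l := 0 :: rcons (sort <=%R (map fst s)) a.
have sl : size l = (size s).+2 by rewrite /= size_rcons size_sort size_map.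
pose t := nth b l.
have la r : r \in l -> 0 <= r <= a.
  rewrite inE mem_rcons inE mem_sort => /or3P[/eqP ->|/eqP ->|].
  - by rewrite lexx.
  - by rewrite a0 lexx.
  - by move=> /mapP[p /Js[/= ? _] ->].
have tS i : t i <= t i.+1.
  have [il|li] := ltnP i.+1 (size l); last first.
    rewrite {2}/t nth_default//; have [il|{}li] := ltnP i (size l).
      by have /la/andP[_ /le_trans] := mem_nth b il; apply.
    by rewrite /t nth_default.
  have : sorted <=%R l.
    rewrite /= rcons_path path_sortedE; last exact: le_trans.
    rewrite sort_sorted ?andbT; last exact: le_total.
    apply/andP; split.
      apply/allP => r rs; suff /la/andP[] : r \in l by [].
      by rewrite inE mem_rcons inE rs !orbT.
    have : last 0 (sort <=%R (map fst s)) \in l.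
      have := mem_last 0 (sort <=%R (map fst s)).
      by rewrite !inE mem_rcons inE => /orP[->//|->]; rewrite !orbT.
    by move=> /la/andP[].
  by move=> /(sortedP b); exact.
have tm : {homo t : i j / (i <= j)%N >-> i <= j}.
  by apply: homo_leq tS => //; exact: le_trans.
have t0 : t 0%N = 0 by [].
have ta : t (size s).+1 = a.
  by rewrite /t/= nth_rcons size_sort size_map ltnn eqxx.
have tb : t (size s).+2 = b by rewrite /t nth_default// sl.
have tge0 i : 0 <= t i by rewrite -t0 tm.
pose X i := M (t i.+1) \- M (t i).
have mX i : measurable_fun setT (X i) by apply: measurable_funB; exact: mM.
have -> : M b \- M a = X (size s).+1 by rewrite /X tb ta.
apply: mutually_independent_past => //.
  by apply: (indM _ t) => //; rewrite t0.
rewrite big_seq; elim/big_ind : _.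
- exact: (sigma_setT (smallest_sigma_algebra _ _)).
- by move=> ? ?; exact: (sigma_setI (smallest_sigma_algebra _ _)).
move=> p ps; have [_ mp] := Js p ps.
have [j jl ->] : exists2 j, (j < (size s).+2)%N & p.1 = t j.
  have pl : p.1 \in l.
    by rewrite inE mem_rcons inE mem_sort map_f ?orbT.
  exists (index p.1 l); first by rewrite -sl index_mem.
  by rewrite /t nth_index.
(* Since [j <= (size s).+1], the telescoping sum involves only increments that precede the one from
   [a] to [b]. *)
have -> : M (t j) \- M 0 = (fun w => \sum_(i < j) X i w).
  apply/funext => w; rewrite -(big_mkord xpredT (fun i => X i w)).
  by rewrite telescope_sumr// t0.
move: p.2 mp; apply/measurable_wrtP; apply: measurable_sum => i.
apply/measurable_wrtP => S mS; apply: (sigma_process_preimage (X := X)) => //=.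
by rewrite -ltnS (leq_trans _ jl)// ltnS ltn_ord.
Qed.

End increments.

(** * Poisson processes at random times *)

Section poisson_mean.
Context d (T : measurableType d) (R : realType) (P : probability T R).
Local Open Scope ereal_scope.

(** For [k > 0], [k] times the mass at [k] is [r] times the mass at [k - 1]. The partial sums are
    thus, up to a shift of the index, [r] times those of the total mass. *)
Lemma poisson_pmf_mean (r : R) : (0 < r)%R ->
  \sum_(k <oo) (k%:R * poisson_pmf r k)%:E = r%:E.
Proof.
move=> r0.
have pmf0 k : 0 <= (poisson_pmf r k)%:E by rewrite lee_fin poisson_pmf_ge0.
have pmf_sum : \sum_(k <oo) (poisson_pmf r k)%:E = 1.
  have := @probability_setT _ _ _ (poisson_prob r 0%N).
  by rewrite /= /poisson_prob r0 -nneseries_esumT.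
have cv : \sum_(0 <= k < n) (r%:E * (poisson_pmf r k)%:E) @[n --> \oo] --> r%:E.
  rewrite [X in _ --> X](_ : _ = \sum_(k <oo) (r%:E * (poisson_pmf r k)%:E)).
    by apply: is_cvg_ereal_nneg_natsum => k _; rewrite mule_ge0// lee_fin ltW.
  by rewrite nneseriesZl// pmf_sum mule1.
apply/cvg_lim => //; rewrite -cvg_shiftS.
rewrite [X in X @ _ --> _](_ : _ =
  (fun n => \sum_(0 <= k < n) (r%:E * (poisson_pmf r k)%:E))); last first.
  apply/funext => n /=; rewrite big_nat_recl// mul0r add0e.
  apply: eq_bigr => k _; rewrite -EFinM /poisson_pmf r0; congr EFin.
  rewrite exprS factS natrM invfM; field.
  by rewrite nat1r !pnatr_eq0 -lt0n fact_gt0.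
exact: cv.
Qed.

Lemma ge0_integral_nat (K : T -> nat) : measurable_fun setT K ->
  \int[P]_w (K w)%:R%:E = \sum_(k <oo) (k%:R)%:E * P [set w | K w = k].
Proof.
move=> mK.
(* [K w] is viewed as a random sum with the single index [K w], so that integration term by term
   runs over the level sets of [K]. *)
under eq_integral do rewrite -(big_nat1 (idx := 0%R) +%R _ (fun k => k%:R : R)).
rewrite (@ge0_integral_random_sum _ _ _ _ _ K (fun w => (K w).+1)
  (fun k _ => k%:R))//; last exact: measurableT_comp.
apply: eq_eseriesr => k _; rewrite setTI.
have -> : [set w | (K w <= k < (K w).+1)%N] = [set w | K w = k].
  by apply/seteqP; split=> w /=; [rewrite ltnS -eqn_leq => /eqP|
    move=> ->; rewrite leqnn ltnS leqnn].
rewrite integral_cst//.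
rewrite (_ : [set _ | _] = K @^-1` [set k])//.
by rewrite -[_ @^-1` _]setTI; exact: mK.
Qed.

End poisson_mean.

Section poisson_increments.
Context d (T : measurableType d) (R : realType) (P : probability T R).
Context (lambda : R) (N : R -> {RV P >-> nat}).
Hypothesis lambda_gt0 : 0 < lambda.
Hypothesis poissonN : poisson_process lambda N.

Let M (t : R) (w : T) : R := (N t w)%:R.

Lemma measurable_poisson t : measurable_fun setT (M t).
Proof. exact: (@measurableT_comp _ _ _ _ _ _ (fun n => n%:R : R)). Qed.

Lemma le_poisson (s t : R) w : 0 <= s -> s <= t -> M s w <= M t w.
Proof. by move=> s0 st; exact: (poisson_nondecreasing poissonN). Qed.

Lemma right_continuous_poisson w : right_continuous_on_pos (M ^~ w).
Proof. by have [] := poisson_cadlag poissonN w. Qed.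

Lemma integral_poisson_increment (s t : R) : 0 <= s -> s <= t ->
  (\int[P]_w (M t w - M s w)%:E = (lambda * (t - s))%:E)%E.
Proof.
move=> s0; rewrite le_eqVlt => /predU1P[->|st].
  under eq_integral do rewrite subrr.
  by rewrite integral0 subrr mulr0.
have Nst w : (N s w <= N t w)%N.
  by rewrite -(ler_nat R); exact: le_poisson (ltW st).
under eq_integral do rewrite -natrB//.
have mB : measurable_fun setT (fun w => (N t w - N s w)%N).
  apply: (@measurable_natr _ _ R).
  under eq_fun do rewrite natrB//.
  by apply: measurable_funB; exact: measurable_poisson.
rewrite ge0_integral_nat//.
have st0 : 0 < lambda * (t - s) by rewrite mulr_gt0// subr_gt0.
rewrite -(poisson_pmf_mean st0); apply: eq_eseriesr => k _.
rewrite EFinM -(poisson_law poissonN k s0 st); congr (_ * P _)%E.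
apply/seteqP; split=> w /=; first by move=> <-; rewrite subnKC.
by move=> ->; rewrite addKn.
Qed.

End poisson_increments.

Section poisson_past.
Context d (T : measurableType d) (R : realType) (P : probability T R).
Context (lambda : R) (N : R -> {RV P >-> nat}) (Y : set_system T).
Hypothesis lambda_gt0 : 0 < lambda.
Hypothesis poissonN : poisson_process lambda N.
Hypothesis sY : sigma_algebra setT Y.
Hypothesis Ym : Y `<=` measurable.
Hypothesis indNY :
  independent_sigma P (sigma_process [set t | 0 <= t] (fun t => N t)) Y.

Let M (t : R) (w : T) : R := (N t w)%:R.

(* The increments from time 0 carry the whole past of N, as N 0 vanishes almost
   everywhere. *)
Definition poisson_past (a : R) : set_system T :=
  sigma_join Y (sigma_process [set r | 0 <= r <= a] (fun r => M r \- M 0)).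

Let mM t : measurable_fun setT (M t).
Proof. exact: measurable_poisson. Qed.

Let leM (s t : R) w : 0 <= s -> s <= t -> M s w <= M t w.
Proof. by move=> *; exact: (le_poisson poissonN). Qed.

Lemma sigma_process_poisson (r : R) B : 0 <= r -> measurable B ->
  sigma_process [set t | 0 <= t] (fun t => N t) (M r @^-1` B).
Proof.
move=> r0 mB.
exact: (sigma_process_preimage (X := fun t => N t) (B := [set n | B n%:R])).
Qed.

Lemma measurable_wrt_poisson (r : R) : 0 <= r ->
  measurable_wrt (sigma_process [set t | 0 <= t] (fun t => N t)) (M r).
Proof. by move=> r0 B; exact: sigma_process_poisson. Qed.

Lemma poisson_past_measurable a : poisson_past a `<=` measurable.
Proof.
apply: sigma_join_sub => //; first exact: sigma_algebra_measurable.
by apply: sigma_process_measurable => r _; exact: measurable_funB.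
Qed.

(** [Y] is independent of the whole of [N], so adding it to the past of [N] does not disturb the
    independence of later increments. *)
Lemma poisson_past_independent (a b : R) C B : 0 <= a -> a <= b ->
  poisson_past a C -> measurable B ->
  P (C `&` (M b \- M a) @^-1` B) = (P C * P ((M b \- M a)%R @^-1` B))%E.
Proof.
move=> a0 ab aC mB; have b0 := le_trans a0 ab.
have sN : sigma_algebra setT (sigma_process [set t | 0 <= t] (fun t => N t)).
  exact: smallest_sigma_algebra.
have mab : measurable_wrt (sigma_process [set t | 0 <= t] (fun t => N t))
    (M b \- M a).
  by apply/measurable_wrtP; apply: measurable_funB;
    apply/measurable_wrtP; exact: measurable_wrt_poisson.
pose H := [set D | exists2 B, measurable B & D = (M b \- M a) @^-1` B].
have past_sub : sigma_process [set r | 0 <= r <= a] (fun r => M r \- M 0) `<=`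
    sigma_process [set t | 0 <= t] (fun t => N t).
  apply: sigma_process_sub => // r D /andP[r0 _] mD.
  move: D mD; apply/measurable_wrtP; apply: measurable_funB;
    by apply/measurable_wrtP; exact: measurable_wrt_poisson.
have mNs : sigma_process [set t | 0 <= t] (fun t => N t) `<=` measurable.
  exact: sigma_process_measurable.
suff indH : independent_sigma P (poisson_past a) H.
  by apply: indH => //; exists B.
apply: independent_sigma_join => //.
- exact: smallest_sigma_algebra.
- by move=> D /past_sub /mNs.
- by move=> _ [D mD ->]; apply: mNs; exact: mab.
move=> D1 D2 _ YD1 MD2 [D3 mD3 ->].
have ND2 := past_sub _ MD2; have ND3 := mab _ mD3.
(* [D2] and [D3] are both events of [N], so [D1] factors out before the increments are separated;
   the same independence then rejoins [D1] and [D2]. *)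
rewrite -setIA setIC indNY//; last exact: (sigma_setI sN).
rewrite (@independent_increments_past _ _ _ _ M a b)//; last first.
  exact: (poisson_independent poissonN).
by rewrite [D1 `&` D2]setIC indNY// muleAC.
Qed.

Lemma integral_poisson_past (a b : R) C : 0 <= a -> a <= b -> poisson_past a C ->
  (\int[P]_(w in C) (M b w - M a w)%:E = (lambda * (b - a))%:E * P C)%E.
Proof.
move=> a0 ab aC; rewrite -(integral_poisson_increment lambda_gt0 poissonN a0 ab).
(* The absolute value makes the integrand a nonnegative function on all of [R] applied to the
   increment, as [ge0_integral_independent] requires. *)
have E A : (\int[P]_(w in A) (M b w - M a w)%:E =
    \int[P]_(w in A) `|(M b \- M a)%R w|%:E)%E.
  by apply: eq_integral => w _; rewrite /= ger0_norm// subr_ge0 leM.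
rewrite !E ge0_integral_independent//; first by rewrite muleC.
- exact: poisson_past_measurable aC.
- exact: measurable_funB.
- by move=> S mS; apply: poisson_past_independent.
Qed.

End poisson_past.

(** * Restriction to an event of probability one *)

Section full_measure.
Context d (T : measurableType d) (R : realType) (P : probability T R).
Context (E : set T).
Hypotheses (mE : measurable E) (PE : P E = 1%E).
Local Open Scope ereal_scope.

Let PCE : P (~` E) = 0.
Proof. by rewrite probability_setC// PE subee. Qed.

Lemma ge0_integral_setI_full (A : set T) (f : T -> \bar R) : measurable A ->
  measurable_fun setT f -> (forall w, 0 <= f w) ->
  \int[P]_(w in A `&` E) f w = \int[P]_(w in A) f w.
Proof.
move=> mA mf f0.
rewrite [RHS](@ge0_negligible_integral _ _ _ _ _ (~` E))// ?setDE ?setCK//.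
- exact: measurableC.
- exact: measurable_funTS.
Qed.

Lemma integral_setI_full (A : set T) (f : T -> \bar R) : measurable A ->
  P.-integrable setT f ->
  \int[P]_(w in A `&` E) f w = \int[P]_(w in A) f w.
Proof.
move=> mA fi.
rewrite [RHS](@negligible_integral _ _ _ _ _ (~` E))// ?setDE ?setCK//.
- exact: measurableC.
- exact: integrableS fi.
Qed.

Lemma measure_setI_full (A : set T) : measurable A -> P (A `&` E) = P A.
Proof.
move=> mA; have := @ge0_integral_setI_full A (cst 1) mA.
by rewrite !integral_cst//= ?mul1e; [apply|exact: measurableI].
Qed.

End full_measure.

Section poisson_wald.
Context d (T : measurableType d) (R : realType) (P : probability T R).
Context (lambda : R) (N : R -> {RV P >-> nat}) (Y : set_system T).
Hypothesis lambda_gt0 : 0 < lambda.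
Hypothesis poissonN : poisson_process lambda N.
Hypothesis sY : sigma_algebra setT Y.
Hypothesis Ym : Y `<=` measurable.
Hypothesis indNY :
  independent_sigma P (sigma_process [set t | 0 <= t] (fun t => N t)) Y.

Let M (t : R) (w : T) : R := (N t w)%:R.

Let mM t : measurable_fun setT (M t).
Proof. exact: measurable_poisson. Qed.

Let leM (s t : R) w : 0 <= s -> s <= t -> M s w <= M t w.
Proof. by move=> *; exact: (le_poisson poissonN). Qed.

Let tick n k w : R := M (mesh n k.+1) w - M (mesh n k) w.

Let mtick n k : measurable_fun setT (tick n k).
Proof. exact: measurable_funB. Qed.

Let tick_ge0 n k w : 0 <= tick n k w.
Proof. by rewrite subr_ge0 leM ?mesh_ge0// le_mesh. Qed.

Let mean_tick n k C : poisson_past N Y (mesh n k) C ->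
  (\int[P]_(w in C) (tick n k w)%:E = (lambda / n.+1%:R)%:E * P C)%E.
Proof.
move=> nC; have := integral_poisson_past lambda_gt0 poissonN sY Ym indNY
  (mesh_ge0 n k) (le_mesh n (leqnSn k)) nC.
move=> ->; congr (_%:E * _)%E.
by rewrite /mesh -mulrBl -natrB// subSnn mul1r.
Qed.

(** The increment of [N] is the sum of its increments over the grid cells from [sg] to [tau].
    Whether cell [k] occurs is decided by [Y], and there [A] may be replaced by an event of the past
    of [mesh n k]; Wald's identity applies with mean [lambda / n.+1] per cell. *)
Lemma integral_poisson_mesh (A E : set T) (sg tau : T -> nat) n :
  measurable A -> measurable E -> P E = 1%E ->
  (forall k, Y [set w | (sg w <= k)%N]) ->
  (forall k, Y [set w | (tau w <= k)%N]) ->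
  measurable_fun setT sg -> measurable_fun setT tau ->
  (forall w, E w -> (sg w <= tau w)%N) ->
  (forall k, exists C, poisson_past N Y (mesh n k) C /\
    A `&` (E `&` [set w | (sg w <= k)%N]) =
    C `&` (E `&` [set w | (sg w <= k)%N])) ->
  (\int[P]_(w in A `&` E) (M (mesh n (tau w)) w - M (mesh n (sg w)) w)%:E =
   lambda%:E * \int[P]_(w in A `&` E) (mesh n (tau w) - mesh n (sg w))%:E)%E.
Proof.
move=> mA mE PE Ysg Ytau msg mtau sgtau AC.
have mAE := measurableI _ _ mA mE.
have -> : (\int[P]_(w in A `&` E)
      (M (mesh n (tau w)) w - M (mesh n (sg w)) w)%:E =
    \int[P]_(w in A `&` E) (\sum_(sg w <= k < tau w) tick n k w)%:E)%E.
  apply: eq_integral => w /set_mem[_ /sgtau sgtauw].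
  by rewrite (telescope_sumr (fun k => M (mesh n k) w)).
have -> : (\int[P]_(w in A `&` E) (mesh n (tau w) - mesh n (sg w))%:E =
    n.+1%:R^-1%:E * \int[P]_(w in A `&` E) (tau w - sg w)%N%:R%:E)%E.
  rewrite -ge0_integralZl//.
  - apply: eq_integral => w /set_mem[_ /sgtau sgtauw].
    by rewrite -EFinM natrB// /mesh -mulrBl mulrC.
  - apply/measurable_EFinP; apply: measurable_funTS.
    rewrite (_ : (fun _ => _) = (fun w => \sum_(sg w <= k < tau w) (1 : R))).
      exact: measurable_random_sum.
    by apply/funext => w; rewrite sumr_const_nat.
rewrite muleA -EFinM; apply: ge0_wald => //.
  by rewrite divr_ge0// ltW.
move=> k; have [C [pC ACE]] := AC k.
pose S := [set w | (sg w <= k < tau w)%N].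
have YS : Y S.
  rewrite (_ : S = [set w | (sg w <= k)%N] `&` ~` [set w | (tau w <= k)%N]).
    by apply: sigma_setI => //; exact: sigma_setC.
  apply/seteqP; split=> w /=.
    by move=> /andP[? ?]; split => //; apply/negP; rewrite -ltnNge.
  by move=> [? /negP]; rewrite -ltnNge => ?; apply/andP.
have pCS : poisson_past N Y (mesh n k) (C `&` S).
  apply: (sigma_setI (smallest_sigma_algebra _ _)) => //.
  exact: sigma_join_l.
have mCS := poisson_past_measurable Ym pCS.
(* As [S] lies in the event [sg <= k], the trace hypothesis trades [A] for [C]; the factor [E] then
   disappears because it has probability one. *)
rewrite -/S; have -> : A `&` E `&` S = C `&` S `&` E.
  have SE : S = [set w | (sg w <= k)%N] `&` S.
    by apply/seteqP; split=> w; [move=> Sw; split => //; have /andP[] := Sw|case].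
  rewrite [in LHS]SE setIA -[A `&` E `&` _]setIA ACE -!setIA -SE.
  by rewrite [E `&` S]setIC.
rewrite ge0_integral_setI_full//.
- by rewrite measure_setI_full//; exact: mean_tick.
- exact/measurable_EFinP.
- by move=> w; rewrite lee_fin.
Qed.

(** Dominated convergence along the grids, for a general [f] because it serves both for the Poisson
    process and for the identity. By monotonicity one bound [g] covers all meshes at once. *)
Lemma cvg_integral_mesh (f : R -> T -> R) (A E : set T) (sg tau : T -> R)
    (g : T -> R) :
  measurable A -> measurable E ->
  (forall t, 0 <= t -> measurable_fun setT (f t)) ->
  (forall w, right_continuous_on_pos (f ^~ w)) ->
  (forall w, nondecreasing_on_pos (f ^~ w)) ->
  measurable_fun setT sg -> measurable_fun setT tau ->
  (forall w, 0 <= sg w) -> (forall w, 0 <= tau w) ->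
  (forall w, E w -> sg w <= tau w) ->
  P.-integrable setT (EFin \o g) ->
  (forall w, f (mesh 0 (grid 0 (tau w)).+1) w - f 0 w <= g w) ->
  (\int[P]_(w in A `&` E) (f (mesh n (grid n (tau w))) w -
      f (mesh n (grid n (sg w))) w)%:E @[n --> \oo] -->
   \int[P]_(w in A `&` E) (f (tau w) w - f (sg w) w)%:E)%E.
Proof.
move=> mA mE mf rf ndf msg mtau sg0 tau0 sgtau gi fg.
have mAE := measurableI _ _ mA mE.
have mft (rho : T -> R) n : measurable_fun setT rho ->
    measurable_fun setT (fun w => f (mesh n (grid n (rho w))) w).
  move=> mrho; apply: (@measurable_nat_index _ _ _ _ (fun k => f (mesh n k))
    (fun w => grid n (rho w))); first by move=> k; apply: mf; exact: mesh_ge0.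
  exact: measurable_grid.
(* The approximation of [x] exceeds it by at most [1 / n.+1 <= 1], so one unit step beyond the first
   integer above [x] bounds the approximations of every mesh. *)
have mgrid_le n (x : R) : 0 <= x ->
    mesh n (grid n x) <= mesh 0 (grid 0 x).+1 :> R.
  move=> x0; apply: le_trans (mesh_grid_le n x0) _.
  rewrite /mesh divr1 -[(grid 0 x).+1%:R]natr1 lerD//.
    by have := lt_mesh_grid 0 x0; rewrite /mesh divr1 => /ltW.
  by rewrite invf_le1// ler1n.
have [| | | | |_ _] := @dominated_convergence _ _ _ P _ mAE
  (fun n w => (f (mesh n (grid n (tau w))) w - f (mesh n (grid n (sg w))) w)%:E)
  (fun w => (f (tau w) w - f (sg w) w)%:E) (EFin \o g).
- move=> n; apply/measurable_EFinP; apply: measurable_funTS.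
  by apply: measurable_funB; exact: mft.
- apply/measurable_EFinP; apply: measurable_funTS.
  by apply: measurable_funB; exact: measurable_random_time.
- apply: aeW => w _ ; apply: cvg_EFin; first exact: nearW.
  apply: cvgB; apply: (@cvg_right_mesh_grid _ (f ^~ w)) => //; exact: rf.
- exact: integrableS gi.
- apply: aeW => w n [_ Ew]; rewrite lee_fin.
  rewrite ger0_norm; last first.
    rewrite subr_ge0; apply: ndf; first exact: mesh_ge0.
    by apply: le_mesh; apply: le_grid; exact: sgtau.
  apply: le_trans (fg w); apply: lerB; apply: ndf => //; try exact: mesh_ge0.
  exact: mgrid_le.
- exact.
Qed.

End poisson_wald.

Lemma ge0_integrable_rv d (T : measurableType d) (R : realType)
    (P : probability T R) (f : T -> R) :
  measurable_fun setT f -> (forall w, 0 <= f w) ->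
  (\int[P]_w (f w)%:E < +oo)%E -> integrable_rv P f.
Proof.
move=> mf f0 foo; apply/integrableP; split; first exact/measurable_EFinP.
by under eq_integral do rewrite /= ger0_norm//.
Qed.

Lemma le_integrable_rv d (T : measurableType d) (R : realType)
    (P : probability T R) (f g : T -> R) :
  measurable_fun setT f -> integrable_rv P g -> (forall w, `|f w| <= g w) ->
  integrable_rv P f.
Proof.
move=> mf gi fg; apply: le_integrable gi => //; first exact/measurable_EFinP.
by move=> w _; rewrite lee_fin/= (le_trans (fg w))// ler_norm.
Qed.

Section integrable_rv.
Context d (T : measurableType d) (R : realType) (P : probability T R).
Implicit Types f g : T -> R.

Lemma integrable_rvD f g : integrable_rv P f -> integrable_rv P g ->
  integrable_rv P (fun w => f w + g w).
Proof. by move=> fi gi; exact: (integrableD measurableT fi gi). Qed.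

Lemma integrable_rvB f g : integrable_rv P f -> integrable_rv P g ->
  integrable_rv P (fun w => f w - g w).
Proof. by move=> fi gi; exact: (integrableB measurableT fi gi). Qed.

Lemma integrable_rvZ (k : R) f : integrable_rv P f ->
  integrable_rv P (fun w => k * f w).
Proof. by move=> fi; exact: (integrableZl measurableT k fi). Qed.

Lemma integrable_rv_cst (k : R) : integrable_rv P (fun=> k).
Proof. exact: finite_measure_integrable_cst. Qed.

End integrable_rv.

(** * Mean of a Poisson process between two independent random times *)

Section poisson_time_change.
Context d (T : measurableType d) (R : realType) (P : probability T R).
Context (lambda : R) (N : R -> {RV P >-> nat}) (Y : set_system T).
Hypothesis lambda_gt0 : 0 < lambda.
Hypothesis poissonN : poisson_process lambda N.
Hypothesis sY : sigma_algebra setT Y.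
Hypothesis Ym : Y `<=` measurable.
Hypothesis indNY :
  independent_sigma P (sigma_process [set t | 0 <= t] (fun t => N t)) Y.

Let M (t : R) (w : T) : R := (N t w)%:R.

Let mM t : measurable_fun setT (M t).
Proof. exact: measurable_poisson. Qed.

Let leM (s t : R) w : 0 <= s -> s <= t -> M s w <= M t w.
Proof. by move=> *; exact: (le_poisson poissonN). Qed.

Let measY (tau : T -> R) : measurable_wrt Y tau -> measurable_fun setT tau.
Proof. by move=> Ytau _ B mB; rewrite setTI; apply: Ym; exact: Ytau. Qed.

Let top (tau : T -> R) w : nat := (grid 0 (tau w)).+1.

Let mesh_top (tau : T -> R) w : 0 <= tau w ->
  mesh 0 (top tau w) <= tau w + 2 :> R.
Proof.
move=> tau0; have := mesh_grid_le 0 tau0.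
by rewrite /mesh divr1 invr1 /top -[(grid 0 (tau w)).+1%:R]natr1; lra.
Qed.

Let Ygrid (tau : T -> R) n k : measurable_wrt Y tau -> (forall w, 0 <= tau w) ->
  Y [set w | (grid n (tau w) <= k)%N].
Proof.
move=> Ytau tau0.
have -> : [set w | (grid n (tau w) <= k)%N] = tau @^-1` `]-oo, mesh n k[.
  by apply/seteqP; split=> w /=; rewrite in_itv/= grid_le_nat.
exact: Ytau.
Qed.

Let mtop (tau : T -> R) : measurable_wrt Y tau -> measurable_fun setT (top tau).
Proof.
move=> /measY mtau; apply: (@measurableT_comp _ _ _ _ _ _ S) => //.
exact: measurable_grid.
Qed.

Let integrable_top (tau : T -> R) : measurable_wrt Y tau ->
  (forall w, 0 <= tau w) -> integrable_rv P tau ->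
  integrable_rv P (fun w => mesh 0 (top tau w)).
Proof.
move=> Ytau tau0 taui.
have mt : measurable_fun setT (fun w => mesh 0 (top tau w) : R).
  by apply: (@measurableT_comp _ _ _ _ _ _ (mesh 0 : nat -> R)) => //; exact: mtop.
apply: (@le_integrable_rv _ _ _ _ _ (fun w => tau w + 2)) => //.
  by apply: integrable_rvD => //; exact: integrable_rv_cst.
by move=> w; rewrite ger0_norm ?mesh_ge0// mesh_top.
Qed.

(** This is the dominating function for the limit along the grids. Its mean comes from the unit
    grid, with indices from [0] to [top tau], and is [lambda] times the finite mean of
    [mesh 0 (top tau w)]. *)
Let integrable_poisson_top (tau : T -> R) : measurable_wrt Y tau ->
  (forall w, 0 <= tau w) -> integrable_rv P tau ->
  integrable_rv P (fun w => M (mesh 0 (top tau w)) w - M 0 w).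
Proof.
move=> Ytau tau0 taui.
apply: ge0_integrable_rv.
- apply: measurable_funB => //.
  by apply: (@measurable_nat_index _ _ _ _ (fun k => M (mesh 0 k)) (top tau)) => //;
    exact: mtop.
- by move=> w; rewrite subr_ge0; apply: leM => //; exact: mesh_ge0.
have mesh00 : mesh 0 0 = 0 :> R by rewrite /mesh mul0r.
have := @integral_poisson_mesh _ _ _ _ lambda N Y lambda_gt0 poissonN sY Ym indNY
  setT setT (fun=> 0%N) (top tau) 0.
rewrite setIT mesh00 => -> //.
- rewrite lte_mul_pinfty// ?lee_fin ?ltW//.
  under eq_integral do rewrite subr0.
  exact: integrable_lty (integrable_top Ytau tau0 taui).
- exact: probability_setT.
- move=> k; rewrite (_ : [set _ | _] = setT); first exact: sigma_setT.
  by apply/seteqP; split.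
- move=> [|k].
    rewrite (_ : [set _ | _] = set0); first by case: sY.
    by apply/seteqP; split.
  rewrite (_ : [set _ | _] = [set w | (grid 0 (tau w) <= k)%N])//.
  exact: Ygrid.
- exact: mtop.
- by move=> k; exists setT; split=> //; exact: sigma_setT (smallest_sigma_algebra _ _).
Qed.

Lemma integrable_poisson_time_change (tau : T -> R) : measurable_wrt Y tau ->
  (forall w, 0 <= tau w) -> integrable_rv P tau ->
  integrable_rv P (fun w => M (tau w) w - M 0 w).
Proof.
move=> Ytau tau0 taui.
apply: le_integrable_rv (integrable_poisson_top Ytau tau0 taui) _.
  apply: measurable_funB => //; apply: measurable_random_time => //.
  - by move=> w; exact: right_continuous_poisson poissonN w.
  - exact: measY.
move=> w; rewrite ger0_norm ?subr_ge0 ?leM// lerB// leM//.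
rewrite (le_trans (ltW (lt_mesh_grid 0 (tau0 w))))//.
exact: le_mesh.
Qed.

(* Only the trace on E of the set A up to the random time sg has to lie in the
   past of N, as the increments of N after sg are all that matters. *)
Lemma integral_poisson_time_change (A E : set T) (sg tau : T -> R) :
  measurable A -> measurable E -> P E = 1%E ->
  measurable_wrt Y sg -> measurable_wrt Y tau ->
  (forall w, 0 <= sg w) -> (forall w, 0 <= tau w) ->
  (forall w, E w -> sg w <= tau w) -> integrable_rv P tau ->
  (forall a, 0 <= a -> exists C, poisson_past N Y a C /\
    A `&` (E `&` [set w | sg w < a]) = C `&` (E `&` [set w | sg w < a])) ->
  (\int[P]_(w in A `&` E) (M (tau w) w - M (sg w) w)%:E =
   lambda%:E * \int[P]_(w in A `&` E) (tau w - sg w)%:E)%E.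
Proof.
move=> mA mE PE Ysg Ytau sg0 tau0 sgtau taui AC.
have msg := measY Ysg; have mtau := measY Ytau.
(* [cv1] is the limit for [N] and [cv2] the one for the identity. Up to the factor [lambda] the two
   sequences coincide by [integral_poisson_mesh], and limits are unique. *)
have cv1 := @cvg_integral_mesh _ _ _ P M A E sg tau _ mA mE (fun t _ => mM t)
  (right_continuous_poisson poissonN) (poisson_nondecreasing poissonN) msg mtau
  sg0 tau0 sgtau (integrable_poisson_top Ytau tau0 taui) (fun=> lexx _).
have rid (w : T) : right_continuous_on_pos (fun t : R => t).
  by move=> t _; apply: cvg_at_right_filter; exact: cvg_id.
have cv2 := @cvg_integral_mesh _ _ _ P (fun t _ => t) A E sg tau _ mA mE
  (fun t _ => measurable_cst t) rid (fun _ _ _ _ => id)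
  msg mtau sg0 tau0 sgtau (integrable_top Ytau tau0 taui).
have top_le w : mesh 0 (grid 0 (tau w)).+1 - 0 <= mesh 0 (top tau w) :> R.
  by rewrite subr0.
have {top_le}cv2 := cvgeZl (isT : lambda%:E \is a fin_num)%E (cv2 top_le).
apply: (cvg_unique _ cv1) => //; apply: cvg_trans cv2.
apply: near_eq_cvg; apply: nearW => n.
rewrite (@integral_poisson_mesh _ _ _ _ lambda _ Y)//.
- by move=> k; exact: Ygrid.
- by move=> k; exact: Ygrid.
- exact: measurable_grid.
- exact: measurable_grid.
- by move=> w /sgtau; exact: le_grid.
move=> k; have [C [pC ACE]] := AC _ (mesh_ge0 n k); exists C; split=> //.
rewrite (_ : [set _ | _] = [set w | sg w < mesh n k])//.
by apply/seteqP; split=> w /=; rewrite grid_le_nat.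
Qed.

End poisson_time_change.

(** * Inverse subordinators *)

Section inverse_process.
Context d (T : measurableType d) (R : realType).
Context (D : R -> T -> R).
Hypothesis mD : forall t, measurable_fun setT (D t).
Hypothesis ndD : forall w, nondecreasing_on_pos (D ^~ w).

(** For nondecreasing paths integer times and levels suffice, and they keep the event measurable. *)
Definition unbounded_paths : set T :=
  \bigcap_(m in [set: nat]) \bigcup_(n in [set: nat]) [set w | m%:R < D n%:R w].

Lemma measurable_unbounded_paths : measurable unbounded_paths.
Proof.
apply: bigcapT_measurable => m; apply: bigcupT_measurable => n.
rewrite -[X in measurable X]setTI; apply: measurable_fun_ltr => //.
Qed.

Let hit t w := [set s | 0 <= s /\ t < D s w].

Let has_lbound_hit t w : has_lbound (hit t w).
Proof. by exists 0 => s []. Qed.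

Lemma inverse_ge0 t w : 0 <= inverse D t w.
Proof.
have [h0|/set0P h0] := eqVneq (hit t w) set0.
  by rewrite /inverse -/(hit t w) h0 inf0.
by apply: lb_le_inf => // s [].
Qed.

(** Unboundedness makes the set of times that hit the higher level nonempty; an empty one would have
    infimum [0] by default and break monotonicity. *)
Lemma le_inverse s t w : unbounded_paths w -> s <= t ->
  inverse D s w <= inverse D t w.
Proof.
move=> Dw st; apply: lb_le_inf.
  have [n _ /= tn] := Dw (Num.truncn t).+1 I.
  by exists n%:R; split => //; exact: lt_trans (truncnS_gt t) tn.
move=> x [x0 tx]; apply: ge_inf; first exact: has_lbound_hit.
by split => //; exact: le_lt_trans tx.
Qed.

Lemma measurable_inverse t : measurable_fun setT (inverse D t).
Proof.
apply: (measurability (@RGenCInfty.G R)) => [|/= _ [_] [x] -> <-].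
  exact: RGenCInfty.measurableE.
rewrite setTI; have [x0|x0] := leP x 0.
  rewrite (_ : _ @^-1` _ = setT)//; apply/seteqP; split=> // w _ /=.
  by rewrite in_itv/= andbT (le_trans x0)// inverse_ge0.
(* For [x > 0], [x <= inverse D t w] means that level [t] is passed at some time but at no time
   below [x]. The first condition excludes the default value [0]; by monotonicity the second need
   only be tested at times increasing to [x]. *)
rewrite (_ : _ @^-1` _ =
  (\bigcup_n [set w | t < D n%:R w]) `&`
  (\bigcap_n [set w | D (x * (n%:R / n.+1%:R)) w <= t])); last first.
  apply/seteqP; split=> w /=; rewrite in_itv/= andbT.
    move=> xt; have [h0|/set0P[s [s0 ts]]] := eqVneq (hit t w) set0.
      move: xt; rewrite /inverse -/(hit t w) h0 inf0 => /(lt_le_trans x0).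
      by rewrite ltxx.
    split.
      exists (Num.truncn s).+1 => //=; apply: lt_le_trans ts _; apply: ndD => //.
      by rewrite ltW// truncnS_gt.
    move=> n _ /=; rewrite leNgt; apply/negP => tD.
    have : inverse D t w <= x * (n%:R / n.+1%:R).
      apply: ge_inf; first exact: has_lbound_hit.
      by split => //; rewrite mulr_ge0// ?divr_ge0// ltW.
    move=> /(le_trans xt); rewrite leNgt => /negP; apply.
    by rewrite gtr_pMr// ltr_pdivrMr// mul1r ltr_nat.
  move=> [[n _ /= tn] Dt]; apply: lb_le_inf; first by exists n%:R; split.
  move=> s [s0 ts]; rewrite leNgt; apply/negP => sx.
  (* Since [k > s / (x - s)], the test time [x * (k / k.+1)] is at least [s], where the path already
     exceeds [t]. *)
  have := Dt (Num.truncn (s / (x - s))).+1 I; set k := (Num.truncn _).+1.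
  rewrite /= leNgt => /negP; apply; apply: lt_le_trans ts _; apply: ndD => //.
  have xs0 : 0 < x - s by rewrite subr_gt0.
  have : s / (x - s) < k%:R by exact: truncnS_gt.
  rewrite ltr_pdivrMr// => sk.
  rewrite mulrA ler_pdivlMr// -natr1; lra.
apply: measurableI.
  apply: bigcupT_measurable => n.
  by rewrite -[X in measurable X]setTI; exact: measurable_fun_ltr.
apply: bigcapT_measurable => n.
by rewrite -[X in measurable X]setTI; exact: measurable_fun_ler.
Qed.

End inverse_process.

Section rate.
Context (R : realType) (Lambda : R -> R).
Hypothesis rateL : rate_function Lambda.

Lemma rate_ge0 x : 0 <= x -> 0 <= Lambda x.
Proof.
by move=> x0; rewrite -(rate_at0 rateL); exact: rate_nondecreasing.
Qed.

Lemma measurable_rate d (T : measurableType d) (Z : T -> R) :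
  measurable_fun setT Z -> (forall w, 0 <= Z w) ->
  measurable_fun setT (fun w => Lambda (Z w)).
Proof.
move=> mZ Z0.
(* [Lambda] is constrained only on the half-line; composing it with the maximum with [0] gives a
   function monotone on [R]. *)
rewrite (_ : (fun _ => _) = (fun x => Lambda (Num.max x 0)) \o Z); last first.
  by apply/funext => w /=; rewrite max_l.
apply: measurableT_comp mZ; apply: nondecreasing_measurable => // x y xy.
apply: (rate_nondecreasing rateL); first by rewrite le_max lexx orbT.
by rewrite ge_max !le_max xy lexx orbT.
Qed.

End rate.

(** * Almost sure unboundedness of the mixed stable subordinator *)

Section mixed_stable.
Context d (T : measurableType d) (R : realType) (P : probability T R).
Context (a1 a2 C1 C2 : R) (D : R -> {RV P >-> R}).
Hypothesis C12 : C1 + C2 = 1.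
Hypothesis stableD : mixed_stable_subordinator a1 a2 C1 C2 D.

(** At [s = 1] both powers equal [1], so the Laplace exponent is [C1 + C2 = 1]. *)
Let laplace_at1 n : (\int[P]_w (expR (- D n%:R w))%:E = (expR (- n%:R))%:E)%E.
Proof.
have [_ lapD] := stableD; have := lapD 1 n%:R ler01 (ler0n _ _).
rewrite !powR1 !mulr1 C12 mulr1 => <-.
by rewrite unlock; apply: eq_integral => w _; rewrite mulN1r.
Qed.

(** On [B m], where the path stays below [m] at all integer times, [expR (- D n)] is at least
    [expR (- m)], while its mean is [expR (- n)]. Letting [n] grow forces [P (B m) = 0]. *)
Lemma unbounded_mixed_stable : P (unbounded_paths (fun t => D t)) = 1%E.
Proof.
pose B (m : nat) := \bigcap_(n in [set: nat]) [set w | D n%:R w <= m%:R].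
have mB m : measurable (B m).
  apply: bigcapT_measurable => n.
  by rewrite -[X in measurable X]setTI; exact: measurable_fun_ler.
have PB m : P (B m) = 0%E.
  have PBn n : ((expR (- m%:R))%:E * P (B m) <= (expR (- n%:R))%:E)%E.
    rewrite -(laplace_at1 n) -integral_cst//.
    apply: (@le_trans _ _ (\int[P]_(w in B m) (expR (- D n%:R w))%:E)%E).
      apply: ge0_le_integral => //.
      - by move=> w _ /=; rewrite lee_fin expR_ge0.
      - apply/measurable_EFinP; apply: measurable_funTS.
        by apply: measurableT_comp => //; exact: measurableT_comp.
      - by move=> w Bw /=; rewrite lee_fin ler_expR lerN2; exact: Bw.
    apply: ge0_subset_integral => //.
      apply/measurable_EFinP.
      by apply: measurableT_comp => //; exact: measurableT_comp.
  have Pfin : P (B m) \is a fin_num by exact: fin_num_measure.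
  rewrite -(fineK Pfin); congr EFin.
  set p := fine _; have p0 : 0 <= p by exact: fine_ge0.
  apply/eqP; rewrite eq_le p0 andbT leNgt; apply/negP => p_gt0.
  (* This [n] satisfies [expR m < p * n <= p * expR n], against the bound [p * expR n <= expR m]. *)
  pose n := (Num.truncn (expR m%:R / p)).+1.
  have := PBn n; rewrite -(fineK Pfin) -/p -EFinM lee_fin.
  rewrite !expRN ler_pdivrMl ?expR_gt0// => pmn.
  have : expR m%:R / p < n%:R by exact: truncnS_gt.
  rewrite ltr_pdivrMr//; apply/negP; rewrite -leNgt.
  have np : n%:R <= expR n%:R :> R by rewrite (le_trans _ (expR_ge1Dx _))// lerDr.
  move: pmn; rewrite ler_pdivlMr ?expR_gt0// => pmn.
  by apply: le_trans pmn; rewrite mulrC ler_wpM2l.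
have -> : unbounded_paths (fun t => D t) = ~` \bigcup_m B m.
  rewrite setC_bigcup; apply: eq_bigcapr => m _; rewrite setC_bigcap.
  apply: eq_bigcupr => n _; apply/seteqP; split=> w /=; rewrite ltNge.
    by move/negP.
  by move/negP.
rewrite probability_setC; last exact: bigcupT_measurable.
rewrite (_ : P (\bigcup_m B m) = 0%E) ?sube0//.
apply/negligibleP; first exact: bigcupT_measurable.
apply: negligible_bigcup => m; apply/negligibleP => //; exact: PB.
Qed.

End mixed_stable.

Section independent_integrals.
Context d (T : measurableType d) (R : realType) (P : probability T R).
Context (F G : set_system T).
Hypotheses (sF : sigma_algebra setT F).
Hypotheses (Fm : F `<=` measurable) (Gm : G `<=` measurable).
Hypothesis indFG : independent_sigma P F G.

Lemma measurable_wrt_indic (f : T -> R) A : measurable_wrt F f -> F A ->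
  measurable_wrt F (fun w => f w * \1_A w).
Proof.
rewrite -(sigma_algebra_id sF) => /measurable_wrtP mf FA.
by apply/measurable_wrtP; apply: measurable_funM => //; exact: measurable_indic.
Qed.

Lemma ge0_integral_independent_sigma (f : T -> R) A B :
  measurable_wrt F f -> (forall w, 0 <= f w) -> F A -> G B ->
  (\int[P]_(w in A `&` B) (f w)%:E = P B * \int[P]_(w in A) (f w)%:E)%E.
Proof.
move=> Ff f0 FA GB; have Ff1 := measurable_wrt_indic Ff FA.
have mA := Fm FA; have mB := Gm GB.
(* Absorbing the indicator of [A] into the integrand leaves an [F]-measurable variable integrated
   over an event of [G]; the absolute value again supplies a nonnegative function on [R]. *)
have E C : measurable C -> (\int[P]_(w in A `&` C) (f w)%:E =
    \int[P]_(w in C) `|f w * \1_A w|%:E)%E.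
  move=> mC; rewrite setIC integral_mkcondr; apply: eq_integral => w _.
  by rewrite patchE indicE; case: ifPn; rewrite /= ?mulr1 ?mulr0 ger0_norm.
rewrite -[in RHS](setIT A) !E// ge0_integral_independent//.
- by move=> _ S mS; rewrite setTI; apply: Fm; exact: Ff1.
- move=> S mS; rewrite setIC [RHS]muleC.
  by apply: indFG => //; exact: Ff1.
Qed.

End independent_integrals.

(** * Claims and the risk process *)

Section claims.
Context d (T : measurableType d) (R : realType) (P : probability T R).
Context (X : nat -> {RV P >-> R}) (H : set_system T).
Hypothesis iidX : iid P (fun i => X i).
Hypotheses (sH : sigma_algebra setT H) (Hm : H `<=` measurable).
Hypothesis indHX :
  independent_sigma P H (sigma_process [set: nat] (fun i => X i)).

Definition claim_past (F : set_system T) (i : nat) : set_system T :=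
  sigma_join F (sigma_process [set j | (j < i)%N] (fun j => X j)).

(** The event of [H] factors out first, since it is independent of all claims jointly; claim [i] is
    then separated from the earlier claims. *)
Lemma claim_past_independent i C B : claim_past H i C -> measurable B ->
  P (C `&` X i @^-1` B) = (P C * P (X i @^-1` B))%E.
Proof.
move=> pC mB; have [indX _] := iidX.
pose K := [set A | exists2 B, measurable B & A = X i @^-1` B].
suff indK : independent_sigma P (claim_past H i) K by apply: indK => //; exists B.
have sub : sigma_process [set j | (j < i)%N] (fun j => X j) `<=`
    sigma_process [set: nat] (fun i => X i).
  apply: sigma_process_sub => [|j S _ mS]; first exact: smallest_sigma_algebra.
  exact: (sigma_process_preimage (X := fun i => X i)).
apply: independent_sigma_join => //.
- exact: smallest_sigma_algebra.
- exact: sigma_process_measurable.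
- by move=> _ [S mS ->]; rewrite -[_ @^-1` _]setTI; exact: measurable_funP.
move=> A1 A2 _ HA1 XA2 [S mS ->].
have XS : sigma_process [set: nat] (fun i => X i) (X i @^-1` S).
  exact: (sigma_process_preimage (X := fun i => X i)).
rewrite -setIA indHX//; last first.
  by apply: (sigma_setI (smallest_sigma_algebra _ _)) => //; exact: sub.
rewrite (@mutually_independent_past _ _ _ _ _ _ (fun i => X i))//.
by rewrite indHX ?muleA//; exact: sub.
Qed.

Lemma integral_claim i (h : R -> R) : measurable_fun setT h ->
  (forall x, 0 <= h x) ->
  (\int[P]_w (h (X i w))%:E = \int[P]_w (h (X 0%N w))%:E)%E.
Proof.
move=> mh h0; have [_ idX] := iidX.
have push j : (\int[P]_w (h (X j w))%:E =
    \int[pushforward P (X j)]_x (h x)%:E)%E.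
  rewrite ge0_integral_pushforward//; first exact/measurable_EFinP.
  by move=> x _; rewrite lee_fin.
by rewrite !push; apply: eq_measure_integral => S mS _; exact: idX.
Qed.

(** Wald's identity for claims: whether claim [i] is counted is decided in [H], and there [A] may be
    replaced by an event independent of [X i]. The function [h] stands for the absolute value or for
    the positive or negative part. *)
Lemma integral_claim_sum (A E : set T) (sg tau : T -> nat) (h : R -> R) :
  measurable A -> measurable E -> P E = 1%E ->
  measurable_fun setT sg -> measurable_fun setT tau ->
  measurable_fun setT h -> (forall x, 0 <= h x) ->
  (\int[P]_w (h (X 0%N w))%:E < +oo)%E ->
  (forall i, H [set w | (sg w <= i < tau w)%N]) ->
  (forall i, exists C, claim_past H i C /\
    A `&` (E `&` [set w | (sg w <= i)%N]) =
    C `&` (E `&` [set w | (sg w <= i)%N])) ->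
  (\int[P]_(w in A `&` E) (\sum_(sg w <= i < tau w) h (X i w))%:E =
   \int[P]_w (h (X 0%N w))%:E *
   \int[P]_(w in A `&` E) (tau w - sg w)%N%:R%:E)%E.
Proof.
move=> mA mE PE msg mtau mh h0 hoo HS AC.
have mhX i : measurable_fun setT (fun w => h (X i w)).
  exact: measurableT_comp.
have hfin : (\int[P]_w (h (X 0%N w))%:E)%E \is a fin_num.
  by rewrite ge0_fin_numE// integral_ge0// => w _; rewrite lee_fin.
rewrite -(fineK hfin); apply: ge0_wald => //.
- exact: measurableI.
- by apply: fine_ge0; apply: integral_ge0 => w _; rewrite lee_fin.
move=> i; have [C [pC ACE]] := AC i.
pose S := [set w | (sg w <= i < tau w)%N].
have pCS : claim_past H i (C `&` S).
  apply: (sigma_setI (smallest_sigma_algebra _ _)) => //.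
  by apply: sigma_join_l; exact: HS.
have mCS : measurable (C `&` S).
  suff : claim_past H i `<=` measurable by apply.
  apply: sigma_join_sub => //; first exact: sigma_algebra_measurable.
  exact: sigma_process_measurable.
rewrite -/S; have -> : A `&` E `&` S = C `&` S `&` E.
  have SE : S = [set w | (sg w <= i)%N] `&` S.
    by apply/seteqP; split=> w; [move=> Sw; split => //; have /andP[] := Sw|case].
  rewrite [in LHS]SE setIA -[A `&` E `&` _]setIA ACE -!setIA -SE.
  by rewrite [E `&` S]setIC.
rewrite ge0_integral_setI_full//; last 2 first.
- exact/measurable_EFinP.
- by move=> w; rewrite lee_fin.
rewrite measure_setI_full// ge0_integral_independent//; last first.
  by move=> B mB; exact: claim_past_independent.
by rewrite fineK// muleC integral_claim.
Qed.

End claims.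

Lemma measurable_wrt_sub d (T : measurableType d) (R : realType)
    (F G : set_system T) (Z : T -> R) :
  F `<=` G -> measurable_wrt F Z -> measurable_wrt G Z.
Proof. by move=> FG mZ B mB; apply: FG; exact: mZ. Qed.

(** * The risk process and its two filtrations *)

Section risk.
Context (R : realType) d (T : measurableType d) (P : probability T R).
Context (a1 a2 C1 C2 : R) (D : R -> {RV P >-> R}) (Lambda : R -> R).
Context (N : R -> {RV P >-> nat}) (X : nat -> {RV P >-> R}) (u mu rho : R).
Hypothesis C12 : C1 + C2 = 1.
Hypothesis stableD : mixed_stable_subordinator a1 a2 C1 C2 D.
Hypothesis rateL : rate_function Lambda.
Hypothesis poissonN : poisson_process 1 N.

Let Y := inverse (fun t => D t).
Let NL := time_changed_count (fun t => N t) Lambda Y.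
Let Risk := risk_process u mu rho Lambda Y NL (fun i => X i).
Let F := claim_filtration NL Y.
Let G := augment F Risk.
Let SY := sigma_process [set t | 0 <= t] Y.
Let H := sigma_join (sigma_process [set t | 0 <= t] NL) SY.
Let SX := sigma_process [set: nat] (fun i => X i).

Hypothesis indNY :
  independent_sigma P (sigma_process [set t | 0 <= t] (fun t => N t)) SY.
Hypothesis iidX : iid P (fun i => X i).
Hypothesis intX : forall i, integrable_rv P (X i).
Hypothesis meanX : ('E_P[X 0%N] = mu%:E)%E.
Hypothesis indHX : independent_sigma P H SX.
Hypothesis intL :
  forall t, 0 <= t -> integrable_rv P (fun w => Lambda (Y t w)).

Let M (t : R) (w : T) : R := (N t w)%:R.
Let tau (t : R) (w : T) : R := Lambda (Y t w).

Let leM (s t : R) w : 0 <= s -> s <= t -> M s w <= M t w.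
Proof. by move=> *; exact: (le_poisson poissonN). Qed.

Let Y_ge0 t w : 0 <= Y t w.
Proof. exact: inverse_ge0. Qed.

Let tau_ge0 t w : 0 <= tau t w.
Proof. exact: rate_ge0. Qed.

Let mY t : measurable_fun setT (Y t).
Proof.
apply: measurable_inverse => //.
by have [subD _] := stableD; exact: subordinator_nondecreasing.
Qed.

Let sSY : sigma_algebra setT SY.
Proof. exact: smallest_sigma_algebra. Qed.

Let mSY : SY `<=` measurable.
Proof. exact: sigma_process_measurable. Qed.

Let SYtau t : 0 <= t -> measurable_wrt SY (tau t).
Proof.
move=> t0; apply/measurable_wrtP; apply: measurable_rate => //.
by apply/measurable_wrtP => B mB; exact: sigma_process_preimage.
Qed.

Let mtau t : measurable_fun setT (tau t).
Proof. exact: measurable_rate. Qed.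

Let mNL t : measurable_fun setT (NL t).
Proof.
apply: (@measurable_natr _ _ R).
apply: (@measurable_random_time _ _ _ M (tau t)) => //.
- by move=> r _; exact: measurable_poisson.
- by move=> w; exact: right_continuous_poisson poissonN w.
Qed.

Let E := unbounded_paths (fun t => D t) `&` [set w | N 0 w = 0%N].

Let mN0 : measurable [set w | N 0 w = 0%N].
Proof.
rewrite (_ : [set _ | _] = N 0 @^-1` [set 0%N])//.
by rewrite -[_ @^-1` _]setTI; exact: measurable_funP.
Qed.

Let mE : measurable E.
Proof. by apply: measurableI => //; exact: measurable_unbounded_paths. Qed.

Let PE : P E = 1%E.
Proof.
rewrite measure_setI_full//; first exact: unbounded_mixed_stable stableD.
  have PN0C : P (~` [set w | N 0 w = 0%N]) = 0%E.
    apply/negligibleP; first exact: measurableC.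
    have [B [mB PB NB]] := poisson_at0 poissonN.
    by exists B; split.
  by rewrite -[X in P X]setCK probability_setC ?PN0C ?sube0//; exact: measurableC.
exact: measurable_unbounded_paths.
Qed.

Let leE (s t : R) w : E w -> s <= t -> tau s w <= tau t w.
Proof.
move=> [Dw _] st; apply: (rate_nondecreasing rateL); first exact: Y_ge0.
exact: le_inverse.
Qed.

Let leNL (s t : R) w : E w -> s <= t -> (NL s w <= NL t w)%N.
Proof.
move=> Ew st; rewrite -(ler_nat R); apply: (@leM (tau s w) (tau t w) w) => //.
exact: leE.
Qed.

Let SYH : SY `<=` H. Proof. exact: sigma_join_r. Qed.

Let sH : sigma_algebra setT H. Proof. exact: smallest_sigma_algebra. Qed.

Let sF t : sigma_algebra setT (F t). Proof. exact: smallest_sigma_algebra. Qed.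

Let sG t : sigma_algebra setT (G t). Proof. exact: smallest_sigma_algebra. Qed.

Let mH : H `<=` measurable.
Proof.
apply: sigma_join_sub => //; first exact: sigma_algebra_measurable.
exact: sigma_process_measurable.
Qed.

Let mSX : SX `<=` measurable.
Proof. exact: sigma_process_measurable. Qed.

Let SYF t : SY `<=` F t. Proof. exact: sigma_join_r. Qed.

Let FG t : F t `<=` G t. Proof. exact: sigma_join_l. Qed.

Let NLF (r t : R) B : 0 <= r -> r <= t -> F t (NL r @^-1` B).
Proof.
move=> r0 rt; apply: sigma_join_l.
by apply: (sigma_process_preimage (X := NL)) => //=; rewrite r0.
Qed.

Let FH t : F t `<=` H.
Proof.
apply: sigma_join_sub => //; apply: sigma_process_sub => // r B /andP[r0 _] _.
by apply: sigma_join_l; exact: (sigma_process_preimage (X := NL)).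
Qed.

Let F_homo (s t : R) : s <= t -> F s `<=` F t.
Proof.
move=> st; apply: sigma_join_sub => //.
apply: sigma_process_sub => // r B /andP[r0 rs] _.
by apply: NLF => //; exact: le_trans st.
Qed.

(** Cutting the sum at [i] claims makes it depend on [K] and on the claims of index below [i] only;
    where [NL r <= i] nothing is lost. *)
Let measurable_risk_truncated (K : set_system T) (i : nat) (r : R) : 0 <= r ->
  sigma_algebra setT K -> SY `<=` K ->
  (forall B, K (NL r @^-1` B)) ->
  measurable_wrt (claim_past X K i)
    (fun w => u + mu * (1 + rho) * tau r w - \sum_(j < minn (NL r w) i) X j w).
Proof.
move=> r0 sK SYK NLK; apply/measurable_wrtP.
apply: measurable_funB.
  apply: measurable_funD => //; apply: measurable_funM => //.
  apply/measurable_wrtP; apply: measurable_wrt_sub (SYtau r0).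
  by apply: subset_trans SYK _; exact: sigma_join_l.
apply: (@measurable_nat_index _ (g_sigma_algebraType _) _ _
  (fun k w => \sum_(j < minn k i) X j w) (NL r)).
  move=> k; apply: measurable_sum => j; apply/measurable_wrtP => B mB.
  apply: sigma_join_r; apply: (sigma_process_preimage (X := fun j => X j)) => //=.
  by rewrite (leq_trans (ltn_ord j))// geq_minr.
by move=> _ B _; rewrite setTI; apply: sigma_join_l; exact: NLK.
Qed.

Let SX_past i : sigma_process [set j | (j < i)%N] (fun j => X j) `<=` SX.
Proof.
apply: sigma_process_sub => [|j B _ mB]; first exact: smallest_sigma_algebra.
exact: (sigma_process_preimage (X := fun j => X j)).
Qed.

(** At each outcome the truncated processes are eventually equal to [Risk r]. *)
Let measurable_risk (K : set_system T) (r : R) : 0 <= r ->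
  sigma_algebra setT K -> SY `<=` K -> (forall B, K (NL r @^-1` B)) ->
  measurable_wrt (sigma_join K SX) (Risk r).
Proof.
move=> r0 sK SYK NLK; apply/measurable_wrtP.
apply: (@measurable_fun_cvg _ (g_sigma_algebraType _) _ _ (fun i w =>
  u + mu * (1 + rho) * tau r w - \sum_(j < minn (NL r w) i) X j w)).
  move=> i; apply/measurable_wrtP.
  apply: measurable_wrt_sub (measurable_risk_truncated r0 sK SYK NLK).
  apply: sigma_join_sub; first exact: smallest_sigma_algebra.
    exact: sigma_join_l.
  by apply: subset_trans (@SX_past i) _; exact: sigma_join_r.
move=> w _; apply: cvg_near_cst; near=> i.
rewrite /Risk /risk_process (minn_idPl _)//.
by near: i; exact: nbhs_infty_ge.
Unshelve. all: by end_near. Qed.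

(** Bounds the augmented filtration by the join of two independent sigma-algebras, on which
    expectations of [dNL] and [dtau] can be compared. *)
Let GFX t : G t `<=` sigma_join (F t) SX.
Proof.
apply: sigma_join_sub; [exact: smallest_sigma_algebra|exact: sigma_join_l|].
apply: sigma_process_sub => [|r B /andP[r0 rt]]; first exact: smallest_sigma_algebra.
move: B; apply: measurable_risk => // B; exact: NLF.
Qed.

Let mG t : G t `<=` measurable.
Proof.
apply: subset_trans (@GFX t) _; apply: sigma_join_sub => //.
  exact: sigma_algebra_measurable.
by apply: subset_trans mH; exact: FH.
Qed.

Lemma filtration_claim : filtration F.
Proof.
split=> [t t0|s t _ st]; last exact: F_homo.
by split => //; apply: subset_trans mH; exact: FH.
Qed.

Lemma filtration_augment : filtration G.
Proof.
split=> [t t0|s t _ st]; first by split.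
apply: sigma_join_sub => //.
  by apply: subset_trans (F_homo st) _; exact: FG.
apply: sigma_process_sub => // r B /andP[r0 rs] mB; apply: sigma_join_r.
by apply: sigma_process_preimage => //=; rewrite r0 (le_trans rs).
Qed.

(** On [E], [r <= s] gives [tau r <= tau s < a], so [N] at time [tau r] is unchanged when [N] is
    stopped at [a]. *)
Let poisson_trace (s a : R) A : F s A -> 0 <= a ->
  exists C, poisson_past N SY a C /\
    A `&` (E `&` [set w | tau s w < a]) = C `&` (E `&` [set w | tau s w < a]).
Proof.
move=> FA a0.
have spast : sigma_algebra setT (poisson_past N SY a).
  exact: smallest_sigma_algebra.
have SYpast : SY `<=` poisson_past N SY a by exact: sigma_join_l.
move: A FA; apply: sigma_trace => // A [|SYA]; last first.
  by exists A; split => //; exact: SYpast.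
move: A; apply: sigma_trace => // _ [r /andP[r0 rs] [B mB <-]].
rewrite setTI.
(* [Q] is [N] stopped at [a], counted from time [0]. It is right-continuous and measurable for the
   past at [a], hence so is its value at [tau r]; on [E] the subtracted term vanishes. *)
pose Q t w := M (Num.min t a) w - M 0 w.
pose B' : set R := \bigcup_(k in B) [set k%:R].
have mB' : measurable B'.
  by apply: bigcup_measurable => k _; exact: measurable_set1.
exists ((fun w => Q (tau r w) w) @^-1` B'); split.
  move: B' mB'; apply/measurable_wrtP.
  apply: (@measurable_random_time _ _ (g_sigma_algebraType _) Q (tau r)).
  - move=> t t0; apply/measurable_wrtP => S mS; apply: sigma_join_r.
    apply: (sigma_process_preimage (X := fun r => M r \- M 0)) => //=.
    by rewrite le_min t0 a0 ge_min lexx orbT.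
  - move=> w t t0; apply: cvgB; last exact: cvg_cst.
    have [ta|at_] := ltP t a.
      apply: cvg_trans (right_continuous_poisson poissonN t0).
      apply: near_eq_cvg; near=> x; rewrite min_l//.
      by near: x; apply: nbhs_right_le.
    apply: cvg_near_cst; near=> x.
    by rewrite min_r// (le_trans at_)//; near: x; exact: nbhs_right_ge.
  - by [].
  - apply/measurable_wrtP; apply: measurable_wrt_sub (SYtau r0).
    exact: sigma_join_l.
have QNL w : E w -> tau s w < a -> Q (tau r w) w = (NL r w)%:R.
  move=> Ew sa; have [_ /= N0] := Ew.
  rewrite /Q /M N0 subr0 min_l//.
  by rewrite (le_trans _ (ltW sa))// leE.
apply/seteqP; split=> w [Bw [Ew sa]]; split=> //.
  by rewrite /= QNL//; exists (NL r w).
move: Bw; rewrite /= QNL// => -[k Bk /eqP].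
by rewrite eqr_nat => /eqP ->.
Unshelve. all: by end_near. Qed.

Let integrable_tau t : 0 <= t -> integrable_rv P (tau t).
Proof. exact: intL. Qed.

(** The truncation at [0] makes it nonnegative on every path, while on [E] it is the plain
    increment. The subtraction in [nat] does the same for [dNL]. *)
Let dtau (s t : R) w : R := Num.max (tau t w - tau s w) 0.

Let dNL (s t : R) w : R := (NL t w - NL s w)%N%:R.

Let dtauE (s t : R) w : E w -> s <= t -> dtau s t w = tau t w - tau s w.
Proof. by move=> Ew st; rewrite /dtau max_l// subr_ge0 leE. Qed.

Let dNLE (s t : R) w : E w -> s <= t ->
  dNL s t w = M (tau t w) w - M (tau s w) w.
Proof. by move=> Ew st; rewrite /dNL natrB// leNL. Qed.

Let measurable_dtau (s t : R) : 0 <= s -> 0 <= t ->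
  measurable_wrt SY (dtau s t).
Proof.
move=> s0 t0; apply/measurable_wrtP; apply: measurable_maxr => //.
by apply: measurable_funB; apply/measurable_wrtP; exact: SYtau.
Qed.

Let measurable_dNL (s t : R) : 0 <= s -> 0 <= t -> measurable_wrt H (dNL s t).
Proof.
move=> s0 t0; apply/measurable_wrtP.
have HNL r : 0 <= r -> @measurable_fun _ _ (g_sigma_algebraType
    (sigma_process [set t | 0 <= t] NL `|` SY)) nat setT (NL r).
  move=> r0 _ B _; rewrite setTI; apply: sigma_join_l.
  exact: (sigma_process_preimage (X := NL)).
apply: (@measurable_nat_index _ (g_sigma_algebraType _) _ _
  (fun k w => (k - NL s w)%N%:R : R) (NL t)); last exact: HNL.
move=> k; apply: (@measurableT_comp _ _ _ _ _ _ (fun n => (k - n)%N%:R : R)) => //.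
exact: HNL.
Qed.

Let integrable_dtau (s t : R) : 0 <= s -> 0 <= t -> integrable_rv P (dtau s t).
Proof.
move=> s0 t0; apply: (@le_integrable_rv _ _ _ _ _ (tau t)).
- by move=> _ B mB; rewrite setTI; apply: mSY; exact: measurable_dtau.
- exact: integrable_tau.
- move=> w; rewrite ger0_norm ?le_max ?lexx ?orbT// ge_max tau_ge0 andbT.
  by rewrite gerBl tau_ge0.
Qed.

Let mdNL (s t : R) : measurable_fun setT (dNL s t).
Proof.
apply: (@measurable_nat_index _ _ _ _
  (fun k w => (k - NL s w)%N%:R : R) (NL t)) => // k.
exact: (@measurableT_comp _ _ _ _ _ _ (fun n => (k - n)%N%:R : R)).
Qed.

Let mNLr t : measurable_fun setT (fun w => (NL t w)%:R : R).
Proof. exact: (@measurableT_comp _ _ _ _ _ _ (fun n => n%:R : R)). Qed.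

Let integrable_NL t : 0 <= t -> integrable_rv P (fun w => (NL t w)%:R).
Proof.
move=> t0; apply: ge0_integrable_rv => //.
rewrite -(ge0_integral_setI_full mE PE)//; last exact/measurable_EFinP.
have Mi := integrable_poisson_time_change ltr01 poissonN sSY mSY indNY (SYtau t0)
  (tau_ge0 t) (integrable_tau t0).
have mM0 : measurable_fun setT (fun w => M (tau t w) w - M 0 w).
  by apply/measurable_EFinP; exact: measurable_int Mi.
apply: (@le_lt_trans _ _ (\int[P]_(w in setT `&` E) (M (tau t w) w - M 0 w)%:E)%E).
  apply: ge0_le_integral => //.
  - exact: measurableI.
  - by apply/measurable_EFinP; apply: measurable_funTS.
  - by apply/measurable_EFinP; apply: measurable_funTS.
  - by move=> w [_ [_ /= N0]]; rewrite lee_fin /M N0 subr0.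
rewrite (integral_setI_full mE PE)//.
exact: integrable_lty Mi.
Qed.

Let integrable_dNL (s t : R) : 0 <= t -> integrable_rv P (dNL s t).
Proof.
move=> t0; apply: le_integrable_rv (integrable_NL t0) _ => // w.
by rewrite ger0_norm// ler_nat leq_subr.
Qed.

Let integral_dNL_poisson (s t : R) A : 0 <= s -> s <= t -> F s A ->
  (\int[P]_(w in A) (dNL s t w)%:E = \int[P]_(w in A) (dtau s t w)%:E)%E.
Proof.
move=> s0 st FA; have t0 := le_trans s0 st.
have mA : measurable A by apply: mH; exact: FH FA.
rewrite -(integral_setI_full mE PE mA (integrable_dNL s t0)).
rewrite -(integral_setI_full mE PE mA (integrable_dtau s0 t0)).
have := @integral_poisson_time_change _ _ _ P 1 N SY ltr01 poissonN sSY mSY indNY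
  A E (tau s) (tau t) mA mE PE (SYtau s0) (SYtau t0) (tau_ge0 s) (tau_ge0 t).
move=> /(_ (fun w Ew => leE Ew st) (integrable_tau t0)).
move=> /(_ (fun a a0 => poisson_trace FA a0)); rewrite mul1e => E1.
under [RHS]eq_integral => w /set_mem[_ Ew] do rewrite /= dtauE//.
by rewrite -E1; apply: eq_integral => w /set_mem[_ Ew]; rewrite /= dNLE.
Qed.

(** On the intersection of an event of [F s] with one of [SX], both integrals acquire the
    probability of the latter as a factor, since [dNL] and [dtau] are measurable for [H]. *)
Let integral_dNL (s t : R) A : 0 <= s -> s <= t -> sigma_join (F s) SX A ->
  (\int[P]_(w in A) (dNL s t w)%:E = \int[P]_(w in A) (dtau s t w)%:E)%E.
Proof.
move=> s0 st; have t0 := le_trans s0 st.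
move: A; apply: integral_eq_sigma_join => //.
- exact: smallest_sigma_algebra.
- by apply: subset_trans mH; exact: FH.
- exact: integrable_dNL.
- exact: integrable_dtau.
move=> A B FA XB; have HA := FH FA.
rewrite !(ge0_integral_independent_sigma sH mH mSX indHX)//.
- by rewrite integral_dNL_poisson.
- by apply: measurable_wrt_sub (measurable_dtau s0 t0).
- by move=> w; rewrite le_max lexx orbT.
- exact: measurable_dNL.
Qed.

(** On [E] with [NL s <= i], the values [Risk r] for [r <= s] involve only claims of index below [i]
    and agree with their truncations. *)
Let claim_trace (s : R) A i : G s A ->
  exists C, claim_past X H i C /\
    A `&` (E `&` [set w | (NL s w <= i)%N]) =
    C `&` (E `&` [set w | (NL s w <= i)%N]).
Proof.
move: A; apply: sigma_trace => [|A [FA|]]; first exact: smallest_sigma_algebra.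
  by exists A; split => //; apply: sigma_join_l; exact: FH FA.
move: A; apply: sigma_trace => [|_ [r /andP[r0 rs] [B mB <-]]].
  exact: smallest_sigma_algebra.
rewrite setTI.
exists ((fun w => u + mu * (1 + rho) * tau r w -
  \sum_(j < minn (NL r w) i) X j w) @^-1` B); split.
  apply: (measurable_risk_truncated r0 sH SYH) => // S.
  by apply: (@FH r); exact: NLF.
have trunc w : E w -> (NL s w <= i)%N -> minn (NL r w) i = NL r w.
  by move=> Ew si; apply/minn_idPl; rewrite (leq_trans _ si)// leNL.
by apply/seteqP; split=> w [Bw [Ew si]]; split=> //; move: Bw;
  rewrite /= trunc.
Qed.

Let H_between (s t : R) i : 0 <= s -> 0 <= t ->
  H [set w | (NL s w <= i < NL t w)%N].
Proof.
move=> s0 t0.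
rewrite (_ : [set w | (NL s w <= i < NL t w)%N] =
  NL s @^-1` [set n | (n <= i)%N] `&` NL t @^-1` [set n | (i < n)%N]).
  by apply: (sigma_setI sH); apply: sigma_join_l;
    exact: (sigma_process_preimage (X := NL)).
by apply/seteqP; split=> w /= => [/andP//|[-> ->]].
Qed.

Let claim_sum (h : R -> R) (s t : R) w : R :=
  \sum_(NL s w <= i < NL t w) h (X i w).

Let measurable_claim_sum (h : R -> R) (s t : R) : measurable_fun setT h ->
  measurable_fun setT (claim_sum h s t).
Proof.
move=> mh; apply: measurable_random_sum => // i; exact: measurableT_comp.
Qed.

(** Combines the two Wald identities: the first turns claims into the count [dNL], the second turns
    the count into [dtau]. *)
Let integral_claim_sum_augment (h : R -> R) (s t : R) A :
  measurable_fun setT h -> (forall x, 0 <= h x) ->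
  integrable_rv P (h \o X 0%N) -> 0 <= s -> s <= t -> G s A ->
  (\int[P]_(w in A `&` E) (claim_sum h s t w)%:E =
   \int[P]_w (h (X 0%N w))%:E * \int[P]_(w in A) (dtau s t w)%:E)%E.
Proof.
move=> mh h0 hi s0 st GA; have t0 := le_trans s0 st; have mA := mG GA.
rewrite (integral_claim_sum iidX sH mH indHX mA mE PE (mNL s) (mNL t) mh h0).
- rewrite -(integral_dNL s0 st (GFX GA)).
  by rewrite -(integral_setI_full mE PE mA (integrable_dNL s t0)).
- exact: integrable_lty hi.
- by move=> i; exact: H_between.
- by move=> i; exact: claim_trace.
Qed.

Let integrable_claim_sum (h : R -> R) (s t : R) :
  measurable_fun setT h -> (forall x, 0 <= h x) ->
  integrable_rv P (h \o X 0%N) -> 0 <= s -> s <= t ->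
  integrable_rv P (claim_sum h s t).
Proof.
move=> mh h0 hi s0 st; have t0 := le_trans s0 st.
apply: ge0_integrable_rv.
- exact: measurable_claim_sum.
- by move=> w; apply: sumr_ge0.
rewrite -(ge0_integral_setI_full mE PE)//; last 2 first.
- by apply/measurable_EFinP; exact: measurable_claim_sum.
- by move=> w; rewrite lee_fin sumr_ge0.
rewrite integral_claim_sum_augment//; last exact: sigma_setT.
rewrite -(fineK (integrable_fin_num measurableT hi)).
rewrite -(fineK (integrable_fin_num measurableT (integrable_dtau s0 t0))).
by rewrite -EFinM ltry.
Qed.

(** The sum of all claims up to [NL t] is dominated by the sum of their absolute values, which
    Wald's identity shows integrable. It starts from index [0], as [NL 0] need not vanish on every
    path. *)
Let integrable_risk t : 0 <= t -> integrable_rv P (Risk t).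
Proof.
move=> t0.
pose S (h : R -> R) w : R := \sum_(0%N <= i < NL t w) h (X i w).
have mS (h : R -> R) : measurable_fun setT h -> measurable_fun setT (S h).
  move=> mh; apply: (@measurable_random_sum _ _ _ (fun=> 0%N)) => // i.
  exact: measurableT_comp.
have normXi : integrable_rv P (Num.norm \o X 0%N).
  exact: integrable_norm (intX 0).
have Si : integrable_rv P (S Num.norm).
  apply: ge0_integrable_rv; first exact: mS.
    by move=> w; apply: sumr_ge0.
  rewrite -[X in (\int[P]_(w in X) _)%E]setIT.
  rewrite (@integral_claim_sum _ _ _ _ _ _ iidX sH mH indHX setT setT (fun=> 0%N)
    (NL t) Num.norm)//.
  - under [X in (_ * X)%E]eq_integral do rewrite subn0.
    rewrite setIT.
    rewrite -(fineK (integrable_fin_num measurableT normXi)).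
    rewrite -(fineK (integrable_fin_num measurableT (integrable_NL t0))).
    by rewrite -EFinM ltry.
  - exact: probability_setT.
  - exact: integrable_lty normXi.
  - move=> i; rewrite (_ : [set _ | _] = NL t @^-1` [set n | (i < n)%N])//.
    by apply: sigma_join_l; exact: (sigma_process_preimage (X := NL)).
  - move=> i; exists setT; split=> //.
    exact: sigma_setT (smallest_sigma_algebra _ _).
rewrite (_ : Risk t = fun w => u + mu * (1 + rho) * tau t w - S id w).
  apply: integrable_rvB; last first.
    apply: le_integrable_rv Si _; first exact: mS.
    by move=> w; exact: ler_norm_sum.
  apply: integrable_rvD; first exact: integrable_rv_cst.
  by apply: integrable_rvZ; exact: integrable_tau.
by apply/funext => w; rewrite /S big_mkord.
Qed.

(** Claims are split into positive and negative parts because Wald's identity is available for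
    nonnegative terms. *)
Let risk_increment (s t : R) w : E w -> s <= t ->
  Risk t w - Risk s w = mu * (1 + rho) * dtau s t w
    - claim_sum (fun x => Num.max x 0) s t w
    + claim_sum (fun x => Num.max (- x) 0) s t w.
Proof.
move=> Ew st; rewrite dtauE// /Risk /risk_process -!(big_mkord xpredT (X ^~ w)).
rewrite (@big_cat_nat _ _ _ (NL s w) 0 (NL t w))//=; last exact: leNL.
rewrite -[X in _ = X]addrA [- _ + claim_sum _ _ _ _]addrC -sumrB.
rewrite [X in _ = _ + X](_ : _ = - \sum_(NL s w <= i < NL t w) X i w).
  by rewrite /tau; ring.
rewrite -sumrN; apply: eq_bigr => i _.
by have [Xi|Xi] := lerP (X i w) 0; [rewrite max_l ?oppr_ge0// subr0|
  rewrite max_r ?oppr_le0 ?ltW// sub0r].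
Qed.

Let integral_risk_increment (s t : R) A : 0 <= s -> s <= t -> G s A ->
  (\int[P]_(w in A) (Risk t w - Risk s w)%:E =
   \int[P]_(w in A) (mu * rho * (tau t w - tau s w))%:E)%E.
Proof.
move=> s0 st GA; have t0 := le_trans s0 st; have mA := mG GA.
have mAE := measurableI _ _ mA mE.
have dRi : integrable_rv P (Risk t \- Risk s).
  by apply: integrable_rvB; exact: integrable_risk.
have dti : integrable_rv P (fun w => mu * rho * (tau t w - tau s w)).
  by apply: integrable_rvZ; apply: integrable_rvB; exact: integrable_tau.
rewrite -(integral_setI_full mE PE mA dRi) -(integral_setI_full mE PE mA dti).
pose pos x : R := Num.max x 0; pose neg x : R := Num.max (- x) 0.
have mpos : measurable_fun setT pos by exact: measurable_maxr.
have mneg : measurable_fun setT neg by apply: measurable_maxr => //.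
have pos0 x : 0 <= pos x by rewrite le_max lexx orbT.
have neg0 x : 0 <= neg x by rewrite le_max lexx orbT.
have posi : integrable_rv P (pos \o X 0%N).
  apply: le_integrable_rv (integrable_norm (intX 0)) _ => [|w].
    exact: measurableT_comp.
  by rewrite ger0_norm//= ge_max normr_ge0 ler_norm.
have negi : integrable_rv P (neg \o X 0%N).
  apply: le_integrable_rv (integrable_norm (intX 0)) _ => [|w].
    exact: measurableT_comp.
  by rewrite ger0_norm//= ge_max normr_ge0 -normrN ler_norm.
have muE : (mu%:E = \int[P]_w (pos (X 0%N w))%:E - \int[P]_w (neg (X 0%N w))%:E)%E.
  rewrite -meanX unlock -integralB//; apply: eq_integral => w _.
  rewrite -EFinB; congr EFin; rewrite /pos /neg.
  by have [Xi|Xi] := lerP (X 0%N w) 0; [rewrite max_l ?oppr_ge0// sub0r opprK|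
    rewrite max_r ?oppr_le0 ?ltW// subr0].
have dtaui := integrable_dtau s0 t0.
have onAE f : integrable_rv P f -> P.-integrable (A `&` E) (EFin \o f).
  by move=> fi; exact: integrableS fi.
have possi := integrable_claim_sum mpos pos0 posi s0 st.
have negsi := integrable_claim_sum mneg neg0 negi s0 st.
have -> : (\int[P]_(w in A `&` E) (Risk t w - Risk s w)%:E =
    \int[P]_(w in A `&` E) ((mu * (1 + rho))%:E * (dtau s t w)%:E -
      (claim_sum pos s t w)%:E + (claim_sum neg s t w)%:E))%E.
  by apply: eq_integral => w /set_mem[_ Ew]; rewrite risk_increment.
have kdi : P.-integrable (A `&` E) (fun w => (mu * (1 + rho))%:E * (dtau s t w)%:E)%E.
  by apply: integrableZl => //; exact: onAE.
rewrite integralD//; [|by apply: integrableB => //; exact: onAE|exact: onAE].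
rewrite integralB//; last exact: onAE.
rewrite integralZl//; last exact: onAE.
rewrite !integral_claim_sum_augment//.
have -> : (\int[P]_(w in A `&` E) (mu * rho * (tau t w - tau s w))%:E =
    (mu * rho)%:E * \int[P]_(w in A `&` E) (dtau s t w)%:E)%E.
  rewrite -integralZl//; last exact: onAE.
  by apply: eq_integral => w /set_mem[_ Ew]; rewrite dtauE.
rewrite (integral_setI_full mE PE mA dtaui).
have dfin : (\int[P]_(w in A) (dtau s t w)%:E)%E \is a fin_num.
  by apply: integrable_fin_num => //; exact: integrableS dtaui.
(* All integrals are finite, so the claim becomes an identity in [R]: with [mu = c1 - c2], the
   premium part without loading cancels the mean claims and leaves [mu * rho * I]. *)
rewrite -(fineK dfin); move: muE.
rewrite -(fineK (integrable_fin_num measurableT posi)).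
rewrite -(fineK (integrable_fin_num measurableT negi)) /=.
set c1 := fine _; set c2 := fine _; set I := fine _ => -[->].
by congr EFin; ring.
Qed.

(** The three cases differ only in [cmp], so they share one proof with explicit conditional
    expectations: the drift [mu * rho * (tau t - tau s)] for the increment, and [Risk s] plus this
    drift for [Risk t]. *)
Lemma risk_martingale_with (cmp : R -> R -> Prop) :
  (forall x v, 0 <= v -> cmp x (x + mu * rho * v)) ->
  increment_martingale_with P cmp F Risk /\ martingale_with P cmp G Risk.
Proof.
move=> cmpP.
have SYZ (s t : R) : 0 <= s -> 0 <= t ->
    measurable_wrt SY (fun w => mu * rho * (tau t w - tau s w)).
  move=> s0 t0; apply/measurable_wrtP; apply: measurable_funM => //.
  by apply: measurable_funB; apply/measurable_wrtP; exact: SYtau.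
have dti (s t : R) : 0 <= s -> 0 <= t ->
    integrable_rv P (fun w => mu * rho * (tau t w - tau s w)).
  move=> s0 t0; apply: integrable_rvZ.
  by apply: integrable_rvB; exact: integrable_tau.
have aeE (Q : T -> Prop) : (forall w, E w -> Q w) -> {ae P, forall w, Q w}.
  move=> EQ; exists (~` E); split; first exact: measurableC.
    by rewrite probability_setC// PE subee.
  by move=> w /= nQ Ew; apply: nQ; exact: EQ.
split; split.
- exact: filtration_claim.
- exact: integrable_risk.
- move=> s t s0 st; have t0 := le_trans s0 st.
  (* The drift is measurable at time [s] although [t] lies in the future, because [F s] contains the
     whole path of [Y]. *)
  exists (fun w => mu * rho * (tau t w - tau s w)); split.
    split.
    + exact: measurable_wrt_sub (@SYF s) (SYZ _ _ s0 t0).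
    + exact: dti.
    + by move=> A FA; rewrite -integral_risk_increment//; exact: FG.
  apply: aeE => w Ew; rewrite -[X in cmp _ X]add0r; apply: cmpP.
  by rewrite subr_ge0 leE.
- exact: filtration_augment.
- move=> t t0 B mB; apply: sigma_join_r.
  by apply: sigma_process_preimage => //=; rewrite t0 lexx.
- exact: integrable_risk.
move=> s t s0 st; have t0 := le_trans s0 st.
have Ri := integrable_risk s0.
have Zi : integrable_rv P (fun w => Risk s w + mu * rho * (tau t w - tau s w)).
  by apply: integrable_rvD => //; exact: dti.
exists (fun w => Risk s w + mu * rho * (tau t w - tau s w)); split.
  split => //.
  + apply/measurable_wrtP; apply: measurable_funD; apply/measurable_wrtP.
      move=> B mB; apply: sigma_join_r.
      by apply: sigma_process_preimage => //=; rewrite s0 lexx.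
    apply: measurable_wrt_sub (SYZ _ _ s0 t0).
    by apply: subset_trans (@FG s); exact: SYF.
  + move=> A GA; have mA := mG GA.
    have onA f : integrable_rv P f -> P.-integrable A (EFin \o f).
      by move=> fi; exact: integrableS fi.
    under eq_integral do rewrite EFinD.
    rewrite integralD//; [|exact: onA|exact/onA/dti].
    rewrite -integral_risk_increment//.
    under [X in (_ + X)%E]eq_integral do rewrite EFinB.
    rewrite integralB//; [|exact/onA/integrable_risk|exact: onA].
    rewrite addeC subeK//.
    by apply: integrable_fin_num => //; exact: onA.
by apply: aeE => w Ew; apply: cmpP; rewrite subr_ge0 leE.
Qed.

End risk.

Theorem theorem4p1 (R : realType) (d : measure_display) (T : measurableType d)
    (P : probability T R)
    (a1 a2 C1 C2 : R) (D : R -> {RV P >-> R})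
    (Lambda : R -> R) (N : R -> {RV P >-> nat})
    (X : nat -> {RV P >-> R}) (u mu rho : R)
    (Y := inverse (fun t => D t))
    (NL := time_changed_count (fun t => N t) Lambda Y)
    (Risk := risk_process u mu rho Lambda Y NL (fun i => X i))
    (F := claim_filtration NL Y)
    (G := augment F Risk) :
  0 < a2 -> a2 < a1 -> a1 < 1 ->
  0 <= C1 -> 0 <= C2 -> C1 + C2 = 1 ->
  mixed_stable_subordinator a1 a2 C1 C2 D ->
  rate_function Lambda ->
  poisson_process 1 N ->
  (* N is independent of Y *)
  independent_sigma P (sigma_process [set t | 0 <= t] (fun t => N t))
                      (sigma_process [set t | 0 <= t] Y) ->
  0 < u -> 0 < mu ->
  iid P (fun i => X i) ->
  (forall i, integrable_rv P (X i)) ->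
  (forall i, 'E_P[X i] = mu%:E)%E ->
  (* (NL, Y) is independent of X *)
  independent_sigma P (sigma_join (sigma_process [set t | 0 <= t] NL)
                                  (sigma_process [set t | 0 <= t] Y))
                      (sigma_process [set: nat] (fun i => X i)) ->
  (* the cumulative intensity has finite mean *)
  (forall t, 0 <= t -> integrable_rv P (fun w => Lambda (Y t w))) ->
  [/\ rho = 0 -> increment_martingale P F Risk /\ martingale P G Risk,
      0 < rho -> increment_submartingale P F Risk /\ submartingale P G Risk
    & rho < 0 -> increment_supermartingale P F Risk /\
                 supermartingale P G Risk].
Proof.
move=> _ _ _ _ _ C12 stableD rateL poissonN indNY _ mu0 iidX intX meanX indHX intL.
have main cmp := risk_martingale_with u C12 stableD rateL poissonN indNY iidX
  intX (meanX 0%N) indHX intL (cmp := cmp) (rho := rho).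
split=> rho0; apply: main => x v v0.
- by rewrite rho0 mulr0 mul0r addr0.
- by rewrite lerDl mulr_ge0// mulr_ge0// ltW.
- by rewrite gerDl mulr_le0_ge0// mulr_ge0_le0// ltW.
Qed.
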